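(* Let $f$ be a smooth and positive function on the unit sphere $\mathbb{S}^n$ such that (1) $f$ is even, i.e. $f(x)=f(-x)$ for all $x\in\mathbb{S}^n$; (2) the matrix $$D^2(f^{-1})-|Df^{-1}|\,I+\frac{f^{-1}}{\frac{8}{n}\max_{\mathbb{S}^n}f+2}\,I$$ is positive semi-definite at every point of $\mathbb{S}^n$. Let $\varphi$ be a smooth, even and $h$-convex solution on $\mathbb{S}^n$ of $$\Delta\varphi-\frac{n}{2}\frac{|D\varphi|^2}{\varphi}+\frac{n}{2}\Big(\varphi-\frac{1}{\varphi}\Big)=\varphi^{-1}f(x),$$ and suppose that for every integer $0\le k\le n-1$ $$\int_{\mathbb{S}^n}\varphi^{k-n}\sigma_{k+1}(U[\varphi])\,d\sigma_{\mathbb{S}^n}=\frac{C_n^{k+1}}{C_n^{k}}\int_{\mathbb{S}^n}\Big[\frac{|D\varphi|^2}{2\varphi}+\frac12(\varphi-\varphi^{-1})\Big]\varphi^{k-n}\sigma_k(U[\varphi])\,d\sigma_{\mathbb{S}^n}.$$ Then $\varphi$ is uniformly $h$-convex.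
   Context: $D$ and $\Delta$ are the covariant derivative and the Laplace operator of the standard round metric on the unit sphere $\mathbb{S}^n$, and $d\sigma_{\mathbb{S}^n}$ is its area element; $f^{-1}=1/f$; $I$ is the identity matrix (matrices are taken with respect to local orthonormal frames, so $I$ corresponds to the metric). Solutions $\varphi$ are positive functions. Put $$U[\varphi]=D^2\varphi-\frac{1}{2}\frac{|D\varphi|^2}{\varphi}I+\frac{1}{2}\Big(\varphi-\frac{1}{\varphi}\Big)I .$$ A solution $\varphi$ is called $h$-convex if $U[\varphi]$ is positive semi-definite everywhere on $\mathbb{S}^n$, and uniformly $h$-convex if $U[\varphi]$ is positive definite everywhere on $\mathbb{S}^n$. Even means $\varphi(x)=\varphi(-x)$ for all $x$. For a symmetric matrix $A$, $\sigma_k(A)$ is the $k$-th elementary symmetric function of its eigenvalues, with $\sigma_0=1$. $C_n^k$ is the binomial coefficient. *)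

(* Defs.v *)
From HB Require Import structures.
From mathcomp Require Import all_boot all_order all_algebra.
From mathcomp Require Import all_classical all_reals all_analysis.
From mathcomp Require Import ring.
From mathcomp Require Import complex.
Set Implicit Arguments.
Unset Strict Implicit.
Unset Printing Implicit Defensive.
Import Order.TTheory GRing.Theory Num.Theory.
Import numFieldNormedType.Exports.
Local Open Scope classical_set_scope.
Local Open Scope ring_scope.

(* The unit sphere S^n sits in 'rV[R]_n.+1.  A function (or vector field) on
   S^n is represented by a function on 'rV[R]_n.+1 of which only the values on
   [sphere] are ever used. *)

Section Euclidean.
Context {R : realType}.

Definition dot {m} (u v : 'rV[R]_m) : R := \sum_(i < m) u 0 i * v 0 i.

(* The norm `|u| of the library on 'rV[R]_m is the sup norm. *)
Definition enorm {m} (u : 'rV[R]_m) : R := Num.sqrt (dot u u).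

Definition sphere n : set 'rV[R]_n.+1 := [set x | dot x x = 1].

End Euclidean.

Arguments sphere R n : clear implicits.

Section SphereCalculus.
Context {R : realType} {n : nat}.
Local Notation E := 'rV[R]_n.+1.

(* The extension of F from the sphere to the complement of the origin that is
   constant along rays. *)
Definition rext {T : Type} (F : E -> T) : E -> T :=
  fun y => F ((enorm y)^-1 *: y).

Definition even_on_sphere (f : E -> R) : Prop :=
  forall x, sphere R n x -> f (- x) = f x.

Definition positive_on_sphere (f : E -> R) : Prop :=
  forall x, sphere R n x -> 0 < f x.

(* F is C^oo on A (meant for A open): every iterated directional derivative,
   including F itself, is differentiable at every point of A. *)
Definition iter_derive (vs : seq E) (F : E -> R) : E -> R :=
  foldr (fun v G => 'D_v G) F vs.

Definition smooth_on (A : set E) (F : E -> R) : Prop :=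
  forall (vs : seq E) (x : E), A x -> differentiable (iter_derive vs F) x.

Definition smooth_on_sphere (f : E -> R) : Prop :=
  smooth_on [set y | y != 0] (rext f).

(* An orthonormal frame at x, stored as the rows of a matrix: the rows other
   than row 0 of the Householder reflection exchanging x and e_0 (for x = e_0
   this is the identity matrix, because 0^-1 = 0). *)
Definition householder (x : E) : 'M[R]_n.+1 :=
  let w := x - delta_mx 0 0 in 1%:M - (2 / dot w w) *: (w^T *m w).

Definition frame (x : E) (a : 'I_n) : E := row (lift ord0 a) (householder x).

(* The gradient D f.  The ambient gradient of [rext f] is already tangent to
   the sphere, since [rext f] is constant along rays. *)
Definition grad (f : E -> R) (x : E) : E :=
  \row_(j < n.+1) 'D_(delta_mx 0 j) (rext f) x.

(* The Levi-Civita connection of the induced (round) metric: the tangential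
   part of the ambient derivative of the vector field X in the direction v. *)
Definition covder (X : E -> E) (v : E) (x : E) : E :=
  let Y := 'D_v (rext X) x in Y - dot Y x *: x.

Definition hess (f : E -> R) (x : E) : 'M[R]_n :=
  \matrix_(a < n, b < n) dot (covder (grad f) (frame x a) x) (frame x b).

Definition laplacian (f : E -> R) (x : E) : R := \tr (hess f x).

Definition Umx (phi : E -> R) (x : E) : 'M[R]_n :=
  hess phi x - (2^-1 * (enorm (grad phi x) ^+ 2 / phi x))%:M
  + (2^-1 * (phi x - (phi x)^-1))%:M.

End SphereCalculus.

Section Matrices.
Context {R : realType} {n : nat}.
Implicit Type A : 'M[R]_n.

Definition psdmx A : Prop := forall v : 'rV[R]_n, 0 <= dot (v *m A) v.

Definition pdmx A : Prop := forall v : 'rV[R]_n, v != 0 -> 0 < dot (v *m A) v.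

(* The eigenvalues of A with multiplicity, provided A has n real ones. *)
Definition eigenvalues A : seq R :=
  xget [::] [set s | char_poly A = \prod_(a <- s) ('X - a%:P)].

Definition sigma (k : nat) A : R :=
  \sum_(I : {set 'I_n} | #|I| == k) \prod_(i in I) (eigenvalues A)`_i.

End Matrices.

Section HConvexity.
Context {R : realType} {n : nat}.
Implicit Type phi : 'rV[R]_n.+1 -> R.

Definition h_convex phi : Prop :=
  forall x, sphere R n x -> psdmx (Umx phi x).

Definition uniformly_h_convex phi : Prop :=
  forall x, sphere R n x -> pdmx (Umx phi x).

End HConvexity.

(* The integral of g over S^n for the area element of the round metric, in
   geodesic polar coordinates (t, w) |-> (cos t, sin t w), with t in [0, pi] and
   w in S^(n-1): the metric is dt^2 + (sin t)^2 g_{S^(n-1)}, so the area element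
   is (sin t)^(n-1) dt dw.  The measure on S^0 = {1, -1} is the counting one. *)
Fixpoint sphere_int {R : realType} (n : nat) : ('rV[R]_n.+1 -> R) -> R :=
  match n with
  | 0 => fun g => g (const_mx 1) + g (const_mx (-1))
  | m.+1 => fun g =>
      \int[lebesgue_measure]_(t in `[0, pi])
        (sin t ^+ m *
         sphere_int (fun w : 'rV[R]_m.+1 =>
           g (row_mx (cos t)%:M (sin t *: w) : 'rV[R]_(1 + m.+1))))
  end.

Section Frame.
Context {R : realType} {n : nat}.
Implicit Types (x w : 'rV[R]_n.+1).

Lemma dotE {m} (u v : 'rV[R]_m) : dot u v = (u *m v^T) 0 0.
Proof. by rewrite /dot mxE; apply: eq_bigr => i _; rewrite mxE. Qed.

Lemma dot_mulmx {m} (u v : 'rV[R]_m) : u *m v^T = (dot u v)%:M.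
Proof. by rewrite [LHS]mx11_scalar dotE. Qed.

Lemma dot_eq0 {m} (u : 'rV[R]_m) : (dot u u == 0) = (u == 0).
Proof.
apply/eqP/eqP => [|->]; last by rewrite /dot big1 // => i _; rewrite mxE mul0r.
move/eqP; rewrite /dot psumr_eq0; last by move=> i _; rewrite -expr2 sqr_ge0.
move=> /allP h; apply/rowP => i; rewrite mxE.
by have /= := h i (mem_index_enum i); rewrite mulf_eq0 orbb => /eqP.
Qed.

Lemma householder_sym x : (householder x)^T = householder x.
Proof. by rewrite /householder linearB linearZ /= trmx_mul trmxK trmx1. Qed.

Lemma householderK x : householder x *m householder x = 1%:M.
Proof.
rewrite /householder /=; move: (x - _) => w.
have [w0|w0] := eqVneq w 0.
  by rewrite w0 mulmx0 scaler0 subr0 mul1mx.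
set c := 2 / _; rewrite mulmxBl mul1mx mulmxBr mulmx1 -scalemxAl.
rewrite -scalemxAr mulmxA -(mulmxA w^T) dot_mulmx mul_mx_scalar -scalemxAl.
rewrite !scalerA.
have -> : c * (c * dot w w) = c + c.
  have : dot w w != 0 by rewrite dot_eq0.
  by rewrite /c => h; field.
by rewrite scalerDl -addrA -opprD addrA subrr subr0.
Qed.

Lemma row0_householder x : sphere R n x -> row ord0 (householder x) = x.
Proof.
rewrite /sphere /= => x1; set e : 'rV[R]_n.+1 := delta_mx 0 0.
rewrite rowE -/e /householder -/e; set w := x - e.
have [w0|w0] := eqVneq w 0.
  rewrite w0 mulmx0 scaler0 subr0 mulmx1.
  by apply/esym/eqP; rewrite -subr_eq0 -/w w0.
rewrite mulmxBr mulmx1 -scalemxAr mulmxA dot_mulmx mul_scalar_mx scalerA.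
have ev (v : 'rV[R]_n.+1) : dot e v = v 0 0.
  by rewrite dotE /e -rowE !mxE.
have ew : dot e w = x 0 0 - 1 by rewrite ev !mxE.
have ww : dot w w = - 2 * (x 0 0 - 1).
  have -> : dot w w = dot x x - 2 * dot e x + dot e e.
    rewrite /dot mulr_sumr -sumrB -big_split /=; apply: eq_bigr => i _.
    by rewrite !mxE; ring.
  by rewrite x1 !ev /e mxE /=; ring.
have h : dot w w != 0 by rewrite dot_eq0.
have -> : 2 / dot w w * dot e w = - 1.
  by rewrite ew ww; rewrite ww mulf_eq0 negb_or in h; case/andP: h => _ h; field.
by rewrite scaleN1r opprK /w addrC subrK.
Qed.

(* [frame x] is an orthonormal basis of the tangent space of the sphere at x. *)
Lemma frame_orthonormal x a b : dot (frame x a) (frame x b) = (a == b)%:R.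
Proof.
have := congr1 (fun M : 'M[R]_n.+1 => M (lift ord0 a) (lift ord0 b)) (householderK x).
rewrite -{2}householder_sym !mxE (inj_eq (@lift_inj _ _)) => <-.
by apply: eq_bigr => i _; rewrite !mxE.
Qed.

Lemma frame_tangent x a : sphere R n x -> dot (frame x a) x = 0.
Proof.
move=> /row0_householder; set H := householder x => {2}<-.
have := congr1 (fun M : 'M[R]_n.+1 => M (lift ord0 a) ord0) (householderK x).
rewrite -{2}householder_sym !mxE [lift _ _ == _]eq_sym (negbTE (neq_lift _ _)) mulr0n => <-.
by apply: eq_bigr => i _; rewrite !mxE.
Qed.

End Frame.

(* A symmetric matrix has n real eigenvalues, so [eigenvalues] is meaningful. *)
Lemma eigenvaluesP {R : realType} {n : nat} (A : 'M[R]_n) : A^T = A ->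
  char_poly A = \prod_(a <- eigenvalues A) ('X - a%:P).
Proof.
move=> Asym; suff [s hs] : exists s : seq R,
    char_poly A = \prod_(a <- s) ('X - a%:P).
  rewrite /eigenvalues; exact: (@xgetPex _ [::]
    [set s | char_poly A = \prod_(a <- s) ('X - a%:P)] (ex_intro _ s hs)).
pose rc : {rmorphism R -> complex R} := real_complex R.
pose B := map_mx rc A.
have Bsym : B \is symmetricmx.
  by apply/is_hermitianmxP; rewrite expr0 scale1r map_mx_id // /B matrix.map_trmx Asym.
have Breal : B \is a realmx.
  by apply/mxOverP => i j; rewrite mxE; apply/complex_realP; eexists.
have Bherm := realsym_hermsym Bsym Breal.
have /hermitian_normalmx/orthomx_spectralP := Bherm.
have /mxOverP := hermitian_spectral_diag_real Bherm.
set P := spectralmx B; set d := spectral_diag B => dreal Beq.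
exists [seq complex.Re (d 0 i) | i <- enum 'I_n].
apply: (map_poly_inj rc); rewrite map_char_poly -/B rmorph_prod /= big_map.
rewrite big_enum /=.
transitivity (char_poly (diag_mx d)).
  have Pu : P \in unitmx by exact: spectral_unit.
  rewrite Beq /char_poly; set D := diag_mx d; set Q := invmx P.
  have QP : map_mx polyC Q *m map_mx polyC P = 1%:M.
    by rewrite -map_mxM mulVmx // map_mx1.
  have -> : char_poly_mx (Q *m D *m P) =
      map_mx polyC Q *m char_poly_mx D *m map_mx polyC P.
    rewrite /char_poly_mx mulmxBr mulmxBl -!map_mxM.
    by rewrite mul_mx_scalar -scalemxAl QP scalemx1.
  by rewrite !det_mulmx mulrAC -det_mulmx QP det1 mul1r.
rewrite char_poly_trig ?diag_mx_is_trig //.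
apply: eq_bigr => i _; rewrite rmorphB /= map_polyX map_polyC /=.
rewrite mxE eqxx mulr1n; congr (_ - _%:P).
by have /complex_realP[r ->] := dreal 0 i.
Qed.

(* Main.v *)
(* In the metric phi^-2 g, conformal to the round metric g, the tensor U / phi is
   the Schouten tensor minus half the metric; it is a Codazzi tensor with trace f,
   and h-convexity says that it is nonnegative.  If it had a null unit vector xi
   at a point x, it would have a minimum in the sense of tensors there.  The
   second-order condition at this minimum, tested on an extension of xi whose
   covariant derivative is a multiple of the identity, gives for g = 1/f
     g_xixi + (2 g_xi phi_xi - <Dg, Dphi>) / phi + g / phi^2 <= 0   at x.
   This contradicts the hypothesis on f as soon as |Dphi| <= phi and
   phi^2 < (8/n) max f + 2, so that no constant rank theorem is needed.

   Both bounds follow from evenness by Sturm comparison along great circles, on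
   which u = phi satisfies 2 u u'' >= u'^2 + 1 - u^2: the first by going from x
   to -x, and, with M = max phi, also phi >= (M + 1/M) / 2 by going from the two
   antipodal maximum points.  At a minimum point of phi the equation gives
   phi^2 <= 1 + (2/n) f, hence (M + 1/M)^2 <= 4 + (8/n) max f.

   All computations are made in the ambient space for the degree-one homogeneous
   extension H(y) = |y| phi(y/|y|), for which U = D^2 H - (|DH|^2 + 1)/(2H) I on
   tangent vectors, so that covariant derivatives become commuting partial ones. *)
Require Import Defs.
From HB Require Import structures.
From mathcomp Require Import all_boot all_order all_algebra.
From mathcomp Require Import all_classical all_reals all_analysis.
From mathcomp Require Import ring lra.
Set Implicit Arguments.
Unset Strict Implicit.
Unset Printing Implicit Defensive.
Import Order.TTheory GRing.Theory Num.Theory.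
Import numFieldNormedType.Exports.
Local Open Scope classical_set_scope.
Local Open Scope ring_scope.

(** * Smooth functions on open sets of the Euclidean space *)

(** Why the test works: let S be the Codazzi tensor, of trace f in the conformal metric, and extend
    xi with covariant derivative s I in that metric. Summing the second-order condition over an
    orthonormal frame, the Codazzi property turns the cross term into 4 s f_xi, and the quadratic
    term is 2 s^2 f. The best choice s = -f_xi/f yields -2 f_xi^2/f, which is exactly what passing
    to the Hessian of 1/f absorbs; this is why the hypothesis concerns 1/f. The Laplacian of S in
    the direction xi becomes the Hessian of the trace, and it is the conformal Hessian that brings
    in the first-order terms (2 f_xi phi_xi - <Df, Dphi>)/phi. For g these terms are, up to sign,
    the pairing of Dphi/phi with the reflection of Dg in the hyperplane orthogonal to xi. A
    reflection keeps lengths, so the bound |Dphi| <= phi costs exactly |Dg|, the gradient term of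
    the hypothesis. The remaining g/phi^2 is compared with the last term of the hypothesis through
    the bound on phi^2. *)

Lemma near_eq_differentiable {R : numFieldType} {V W : normedModType R}
    (f g : V -> W) (x : V) :
  (\forall y \near x, f y = g y) -> differentiable f x -> differentiable g x.
Proof.
move=> fg df; have -> : g = f + (g - f) by apply/funext => y; rewrite !fctE addrC subrK.
apply: differentiableD => //.
(* The differential is picked by choice among the continuous linear maps with the right expansion,
   so it is enough to exhibit one: the zero map. *)
apply/diffP; apply: (@getPex _ (fun (dg : {linear V -> W}) => continuous dg /\
  forall y, (g - f) y = (g - f) (lim (nbhs x)) + dg (y - lim (nbhs x))
                  +o_(y \near x) (y - lim (nbhs x)))).
exists ((@GRing.null_fun V W) : {linear V -> W}); split; first exact: cst_continuous.
apply: eqaddoEx => y; rewrite lim_id // [in RHS]/= addr0.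
have -> : (g - f) x = 0 by rewrite !fctE (nbhs_singleton fg) subrr.
rewrite add0r; move: y; apply/funeqP/eqoP => _/posnumP[e]; near=> y.
have -> : (g - f) y = 0 by rewrite !fctE (_ : f y = g y) ?subrr//; near: y.
by rewrite normr0 mulr_ge0.
Unshelve. all: by end_near. Qed.

Section SmoothFunctions.
Context {R : realType} {n : nat}.
Local Notation E := 'rV[R]_n.+1.
Implicit Types (A : set E) (F G : E -> R).

Lemma derive_eq_on A F G (v x : E) : open A -> A x ->
  (forall y, A y -> F y = G y) -> 'D_v F x = 'D_v G x.
Proof.
move=> oA Ax FG; apply: near_eq_derive; near=> y; apply: FG.
by near: y; exact: open_nbhs_nbhs.
Unshelve. all: by end_near. Qed.

Lemma differentiable_eq_on A F G (x : E) : open A -> A x ->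
  (forall y, A y -> F y = G y) -> differentiable F x -> differentiable G x.
Proof.
move=> oA Ax FG; apply: near_eq_differentiable; near=> y; apply: FG.
by near: y; exact: open_nbhs_nbhs.
Unshelve. all: by end_near. Qed.

Lemma iter_derive_eq_on A F G vs : open A ->
  (forall y, A y -> F y = G y) ->
  forall y, A y -> iter_derive vs F y = iter_derive vs G y.
Proof.
move=> oA FG; elim: vs => [|v vs IH] y Ay /=; first exact: FG.
exact: derive_eq_on Ay IH.
Qed.

Lemma smooth_eq_on A F G : open A -> (forall y, A y -> F y = G y) ->
  smooth_on A F -> smooth_on A G.
Proof.
move=> oA FG sF vs x Ax; apply: (differentiable_eq_on oA Ax _ (sF vs x Ax)).
exact: iter_derive_eq_on.
Qed.

Lemma smooth_derive A F v : smooth_on A F -> smooth_on A ('D_v F).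
Proof.
by move=> sF vs x Ax; have := sF (rcons vs v) x Ax; rewrite /iter_derive foldr_rcons.
Qed.

Lemma smooth_differentiable A F x : smooth_on A F -> A x -> differentiable F x.
Proof. by move=> sF Ax; exact: (sF [::]). Qed.

Lemma smooth_derivable A F x v : smooth_on A F -> A x -> derivable F x v.
Proof. by move=> sF Ax; apply: diff_derivable; exact: smooth_differentiable Ax. Qed.

(* Differentiability to order [k], with the innermost derivative peeled off
   first: unlike [smooth_on] it lends itself to induction on the order. *)
Fixpoint diff_upto (k : nat) A F : Prop :=
  (forall x, A x -> differentiable F x) /\
  match k with 0%N => True | k'.+1 => forall v, diff_upto k' A ('D_v F) end.

Lemma diff_upto_differentiable k A F x :
  diff_upto k A F -> A x -> differentiable F x.
Proof. by case: k => [|k] [h _]; exact: h. Qed.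

Lemma smooth_onP A F : smooth_on A F <-> forall k, diff_upto k A F.
Proof.
split=> [sF k|dF vs x Ax].
  elim: k F sF => [|k IH] F sF /=; split=> //.
  - by move=> x; exact: smooth_differentiable.
  - by move=> x; exact: smooth_differentiable.
  - by move=> v; apply: IH; exact: smooth_derive.
have := dF (size vs); elim/last_ind: vs F {dF} => [|vs v IH] F.
  by move=> /= [+ _]; exact.
by rewrite size_rcons /= /iter_derive foldr_rcons => -[_ /(_ v)]; exact: IH.
Qed.

Lemma diff_upto_eq k A F G : open A -> (forall y, A y -> F y = G y) ->
  diff_upto k A F -> diff_upto k A G.
Proof.
move=> oA; elim: k F G => [|k IH] F G FG /= [dF rF]; split=> //.
- by move=> x Ax; exact: differentiable_eq_on Ax FG (dF x Ax).
- by move=> x Ax; exact: differentiable_eq_on Ax FG (dF x Ax).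
- move=> v; apply: (IH ('D_v F)) => // y Ay; exact: derive_eq_on Ay FG.
Qed.

Lemma diff_uptoW k A F : diff_upto k.+1 A F -> diff_upto k A F.
Proof.
elim: k F => [|k IH] F [dF rF]; split=> // v; apply: IH; exact: rF.
Qed.

Lemma diff_uptoD k A F G : open A -> diff_upto k A F -> diff_upto k A G ->
  diff_upto k A (F \+ G).
Proof.
move=> oA; elim: k F G => [|k IH] F G /= [dF rF] [dG rG]; split=> //.
- by move=> x Ax; apply: differentiableD; auto.
- by move=> x Ax; apply: differentiableD; auto.
- move=> v; apply: (diff_upto_eq (F := 'D_v F \+ 'D_v G)) => //; last by auto.
  by move=> y Ay; rewrite deriveD //; apply: diff_derivable; auto.
Qed.

Lemma diff_uptoM k A F G : open A -> diff_upto k A F -> diff_upto k A G ->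
  diff_upto k A (F \* G).
Proof.
move=> oA; elim: k F G => [|k IH] F G hF hG.
  by split=> // x Ax; apply: differentiableM; apply: (@diff_upto_differentiable 0 A).
have [[dF rF] [dG rG]] := (hF, hG); split=> [x Ax|v].
  by apply: differentiableM; auto.
apply: (diff_upto_eq (F := (F \* 'D_v G) \+ (G \* 'D_v F))) => //.
  move=> y Ay; rewrite /= [in RHS](@deriveM _ _ F G) //; apply: diff_derivable; auto.
by apply: diff_uptoD => //; apply: IH;
  solve [exact: diff_uptoW | exact: rF | exact: rG].
Qed.

Lemma smoothD A F G : open A -> smooth_on A F -> smooth_on A G ->
  smooth_on A (F \+ G).
Proof. by move=> oA /smooth_onP sF /smooth_onP sG; apply/smooth_onP => k; exact: diff_uptoD. Qed.

Lemma smoothM A F G : open A -> smooth_on A F -> smooth_on A G ->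
  smooth_on A (F \* G).
Proof. by move=> oA /smooth_onP sF /smooth_onP sG; apply/smooth_onP => k; exact: diff_uptoM. Qed.

Lemma smooth_cst A (c : R) : smooth_on A (cst c).
Proof.
suff h vs : exists d, iter_derive vs (cst c : E -> R) = cst d.
  by move=> vs x _; have [d ->] := h vs; exact: differentiable_cst.
elim: vs => [|v vs [d IH]] /=; first by exists c.
by exists 0; rewrite -/(iter_derive vs _) IH; apply/funext => x; rewrite derive_cst.
Qed.

Lemma smooth_sum A m (F : 'I_m -> E -> R) : open A ->
  (forall i, smooth_on A (F i)) -> smooth_on A (fun y => \sum_i F i y).
Proof.
move=> oA; elim: m F => [|m IH] F sF.
  rewrite (_ : (fun _ => _) = cst 0); first exact: smooth_cst.
  by apply/funext => y; rewrite big_ord0.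
rewrite (_ : (fun _ => _) = F ord0 \+ (fun y => \sum_i F (lift ord0 i) y)).
  by apply: smoothD => //; apply: IH.
by apply/funext => y; rewrite big_ord_recl.
Qed.

(** The derivative of 1/F is -F' (1/F)^2, in which 1/F occurs undifferentiated, so order k for 1/F
    yields order k+1. *)
Lemma smooth_inv A F : open A -> (forall x, A x -> F x != 0) ->
  smooth_on A F -> smooth_on A (fun y => (F y)^-1).
Proof.
move=> oA F0 /smooth_onP sF; apply/smooth_onP; elim=> [|k IH].
  split=> // x Ax; apply: differentiableV => //; last exact: F0.
  exact: (@diff_upto_differentiable 0 A).
have dI x : A x -> differentiable (fun y => (F y)^-1) x.
  by move=> Ax; exact: diff_upto_differentiable IH Ax.
split=> // v; pose I := fun y => (F y)^-1.
apply: (diff_upto_eq (F := (cst (- 1) \* ('D_v F)) \* (I \* I))) => //.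
  move=> y Ay /=; rewrite deriveV ?F0 //.
    by rewrite /I /GRing.scale /=; field; exact: F0.
  by apply: diff_derivable; exact: (@diff_upto_differentiable 0 A).
apply: diff_uptoM => //; last by apply: diff_uptoM.
apply: diff_uptoM => //; last by have [_] := sF k.+1; exact.
by move: k {IH dI}; apply/smooth_onP; exact: smooth_cst.
Qed.

End SmoothFunctions.

(** * Second-order jets of functions of one real variable *)

Section Jets.
Context {R : realType}.
Implicit Types (g h : R -> R) (a b c : R).

(* [a], [b], [c] are the value and the first two derivatives of [g] at [0]. *)
Definition jet2 g a b c : Prop := exists dg : R -> R,
  [/\ g 0 = a, dg 0 = b, \forall t \near (0 : R), is_derive (t : R) 1 g (dg t)
    & is_derive (0 : R) 1 dg c].

Lemma jet2_cst a : jet2 (fun=> a) a 0 0.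
Proof. by exists (fun=> 0); split=> //; [near=> t; exact: is_derive_cst | exact: is_derive_cst].
Unshelve. all: by end_near. Qed.

Lemma jet2_id : jet2 id 0 1 0.
Proof. by exists (fun=> 1); split=> //; [near=> t; exact: is_derive_id | exact: is_derive_cst].
Unshelve. all: by end_near. Qed.

Lemma jet2D g h a b c a' b' c' : jet2 g a b c -> jet2 h a' b' c' ->
  jet2 (fun t => g t + h t) (a + a') (b + b') (c + c').
Proof.
move=> [dg [<- <- g1 g2]] [dh [<- <- h1 h2]]; exists (dg \+ dh); split=> //.
  near=> t; have G : is_derive t 1 g (dg t) by near: t.
  have H : is_derive t 1 h (dh t) by near: t.
  exact: is_deriveD.
exact: is_deriveD.
Unshelve. all: by end_near. Qed.

Lemma jet2M g h a b c a' b' c' : jet2 g a b c -> jet2 h a' b' c' ->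
  jet2 (fun t => g t * h t) (a * a') (b * a' + a * b') (c * a' + 2 * b * b' + a * c').
Proof.
move=> [dg [ga gb g1 g2]] [dh [ha hb h1 h2]].
exists (fun t => dg t * h t + g t * dh t); split.
- by rewrite ga ha.
- by rewrite ga ha gb hb.
- near=> t; have G : is_derive t 1 g (dg t) by near: t.
  have H : is_derive t 1 h (dh t) by near: t.
  by apply: is_derive_eq; rewrite /GRing.scale /=; ring.
- have G := nbhs_singleton g1; have H := nbhs_singleton h1.
  by apply: is_derive_eq; rewrite /GRing.scale /= ga gb ha hb; ring.
Unshelve. all: by end_near. Qed.

Lemma jet2_sum m (g : 'I_m -> R -> R) (a b c : 'I_m -> R) :
  (forall i, jet2 (g i) (a i) (b i) (c i)) ->
  jet2 (fun t => \sum_i g i t) (\sum_i a i) (\sum_i b i) (\sum_i c i).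
Proof.
elim: m g a b c => [|m IH] g a b c H.
  rewrite !big_ord0 (_ : (fun _ => _) = (fun=> 0)); first exact: jet2_cst.
  by apply/funext => t; rewrite big_ord0.
rewrite !big_ord_recl.
rewrite (_ : (fun _ => _) = (fun t => g ord0 t + \sum_i g (lift ord0 i) t)).
  by apply: jet2D => //; exact: IH.
by apply/funext => t; rewrite big_ord_recl.
Qed.

Lemma jet2_unique g a b c a' b' c' : jet2 g a b c -> jet2 g a' b' c' ->
  [/\ a = a', b = b' & c = c'].
Proof.
move=> [dg [<- <- g1 g2]] [dh [<- <- h1 h2]].
have gh : \forall t \near (0 : R), dg t = dh t.
  near=> t; have G : is_derive t 1 g (dg t) by near: t.
  have H : is_derive t 1 g (dh t) by near: t.
  by rewrite -(@derive_val _ _ _ _ _ _ _ G) (@derive_val _ _ _ _ _ _ _ H).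
split=> //; first exact: nbhs_singleton gh.
by rewrite -(@derive_val _ _ _ _ _ _ _ g2) -(@derive_val _ _ _ _ _ _ _ h2); exact: near_eq_derive.
Unshelve. all: by end_near. Qed.

Lemma jet2_near g h a b c : (\forall t \near (0 : R), g t = h t) ->
  jet2 g a b c -> jet2 h a b c.
Proof.
move=> gh [dg [<- <- g1 g2]]; exists dg; split=> //.
  by apply/esym; exact: nbhs_singleton gh.
near=> t; apply: (@near_eq_is_derive _ _ _ g); last by near: t.
by near: t; exact: (near_join gh).
Unshelve. all: by end_near. Qed.

Lemma jet2_min g a b c : jet2 g a b c -> (\forall t \near (0 : R), a <= g t) ->
  b = 0 /\ 0 <= c.
Proof.
move=> [dg [ga gb g1 g2]] gmin.
have [d /= d0 dP] : \forall t \near (0 : R), is_derive (t : R) 1 g (dg t) /\ a <= g t.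
  by near=> t; split; near: t.
have dH (t : R) : `|t| < d -> is_derive t 1 g (dg t) /\ a <= g t.
  by move=> td; apply: dP; rewrite /ball_ /= sub0r normrN.
have b0 : b = 0.
  have h0 : is_derive (0 : R) 1 g 0.
    apply: (@derive1_at_min _ g (- d) d); rewrite ?in_itv /= ?oppr_lt0 ?d0 //.
    - by rewrite ge0_cp // ltW.
    - move=> t; rewrite in_itv /= -ltr_norml => /dH[h _]; exact: ex_derive.
    - by move=> t; rewrite in_itv /= -ltr_norml ga => /dH[_].
  have h1 : is_derive (0 : R) 1 g (dg 0) by have [] := dH 0; rewrite ?normr0.
  by rewrite -gb -(@derive_val _ _ _ _ _ _ _ h1) (@derive_val _ _ _ _ _ _ _ h0).
(* Since [dg 0 = 0], a negative [c] makes [dg] negative just to the right of 0, and the mean value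
   theorem then brings [g] below its minimum. *)
split=> //; rewrite leNgt; apply/negP => c0.
have [e /= e0 eP] : \forall h \near (0 : R)^', (h : R)^-1 *: (dg (h *: 1 + 0) - dg 0) < c / 2.
  have /cvgr_lt : (fun h : R => h^-1 *: ((dg \o shift 0) (h *: 1) - dg 0)) @ 0^' --> c.
    by rewrite -(@derive_val _ _ _ _ _ _ _ g2); exact: (@ex_derive _ _ _ _ _ _ _ g2).
  apply; lra.
have dgneg (t : R) : 0 < t < e -> dg t < 0.
  move=> /andP[t0 te]; have := eP t; rewrite /ball_ /= sub0r normrN gtr0_norm // => /(_ te).
  rewrite gt_eqF // => /(_ isT).
  rewrite gb b0 subr0 addr0 /GRing.scale /= mulr1 ltr_pdivrMl //; nra.
pose s := Num.min d e / 2.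
have s0 : 0 < s by rewrite divr_gt0 // lt_min d0.
have [sd se] : s < d /\ s < e.
  have : Num.min d e <= d by rewrite ge_min lexx.
  have : Num.min d e <= e by rewrite ge_min lexx orbT.
  by move: s0; rewrite /s => ? ? ?; split; lra.
have [||t] := @MVT _ g dg 0 s s0.
- move=> x; rewrite in_itv /= => /andP[x0 xs].
  by have [] := dH x; rewrite // gtr0_norm // (lt_trans xs).
- apply: derivable_within_continuous => x; rewrite in_itv /= => /andP[x0 xs].
  by have [] := dH x => //; rewrite ger0_norm // (le_lt_trans xs).
rewrite in_itv /= => /andP[t0 ts]; rewrite ga subr0 => E.
have [|_ gs] := dH s; first by rewrite gtr0_norm.
have : dg t < 0 by apply: dgneg; rewrite t0 (lt_trans ts).
nra.
Unshelve. all: by end_near. Qed.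

End Jets.

(** * Smooth functions restricted to lines *)

Section Directional.
Context {R : realType} {n : nat}.
Local Notation E := 'rV[R]_n.+1.
Implicit Types (A : set E) (F G : E -> R).

Lemma is_derive_line F (x u : E) (t : R) : derivable F (x + t *: u) u ->
  is_derive t 1 (fun s => F (x + s *: u)) ('D_u F (x + t *: u)).
Proof.
have e : (fun h : R => h^-1 *: (((fun s => F (x + s *: u)) \o shift t) (h *: 1) -
        F (x + t *: u))) =
   (fun h : R => h^-1 *: ((F \o shift (x + t *: u)) (h *: u) - F (x + t *: u))).
  apply/funext => h /=; congr (_ *: (F _ - _)).
  by rewrite [h *: 1]mulr1 scalerDl addrCA.
by move=> dF; apply: DeriveDef; rewrite /derivable /derive e.
Qed.

Lemma nbhs_line A (x u : E) : open A -> A x -> \forall t \near (0 : R), A (x + t *: u).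
Proof.
move=> oA Ax.
have c : (fun t : R => x + t *: u) @ 0 --> x + 0 *: u.
  by apply: cvgD; [exact: cvg_cst | apply: cvgZr_tmp; exact: cvg_id].
by apply: c; rewrite scale0r addr0; exact: open_nbhs_nbhs.
Qed.

Lemma jet2_line A F (x u : E) : open A -> smooth_on A F -> A x ->
  jet2 (fun t => F (x + t *: u)) (F x) ('D_u F x) ('D_u ('D_u F) x).
Proof.
move=> oA sF Ax; exists (fun t => 'D_u F (x + t *: u)); split.
- by rewrite scale0r addr0.
- by rewrite scale0r addr0.
- near=> t; apply: is_derive_line; apply: smooth_derivable sF _.
  by near: t; exact: nbhs_line.
- rewrite -[X in 'D_u _ X]addr0 -[X in _ + X](scale0r u).
  apply: is_derive_line; rewrite scale0r addr0.
  exact: smooth_derivable (smooth_derive _ sF) Ax.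
Unshelve. all: by end_near. Qed.

Lemma derive_linear A F (x : E) (a : R) (u v : E) : smooth_on A F -> A x ->
  'D_(a *: u + v) F x = a * 'D_u F x + 'D_v F x.
Proof.
move=> sF Ax; have dF := smooth_differentiable sF Ax.
by rewrite !deriveE // linearP.
Qed.

Lemma derive_sumv A F (x : E) m (c : 'I_m -> R) (u : 'I_m -> E) :
  smooth_on A F -> A x ->
  'D_(\sum_i c i *: u i) F x = \sum_i c i * 'D_(u i) F x.
Proof.
move=> sF Ax; have dF := smooth_differentiable sF Ax.
rewrite deriveE // linear_sum; apply: eq_bigr => i _.
by rewrite linearZ /= deriveE.
Qed.

End Directional.

(** * Symmetry of second derivatives *)

Section Schwarz.
Context {R : realType} {n : nat}.
Local Notation E := 'rV[R]_n.+1.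
Implicit Types (A : set E) (F G : E -> R).

(* The left-hand side is symmetric in [u] and [v], which yields the symmetry of
   second derivatives by continuity. *)
Lemma second_difference_mean A F (x u v : E) (h : R) : smooth_on A F -> 0 < h ->
  (forall s t, 0 <= s <= h -> 0 <= t <= h -> A (x + s *: u + t *: v)) ->
  exists s t, [/\ 0 <= s <= h, 0 <= t <= h &
    F (x + h *: u + h *: v) - F (x + h *: u) - F (x + h *: v) + F x
      = h * h * 'D_v ('D_u F) (x + s *: u + t *: v)].
Proof.
move=> sF h0 hA; pose g (s : R) := F (x + h *: v + s *: u) - F (x + s *: u).
have A1 s : 0 <= s <= h -> A (x + h *: v + s *: u).
  by move=> hs; rewrite addrAC; apply: hA => //; rewrite lexx ltW.
have A2 s : 0 <= s <= h -> A (x + s *: u).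
  by move=> hs; rewrite -[X in A X]addr0 -(scale0r v); apply: hA => //; rewrite lexx ltW.
have dg (s : R) : 0 <= s <= h ->
    is_derive s 1 g ('D_u F (x + h *: v + s *: u) - 'D_u F (x + s *: u)).
  move=> hs; apply: is_deriveB; apply: is_derive_line.
    exact: smooth_derivable sF (A1 _ hs).
  exact: smooth_derivable sF (A2 _ hs).
have [||s shI gE] := @MVT _ g
    (fun s => 'D_u F (x + h *: v + s *: u) - 'D_u F (x + s *: u)) 0 h h0.
- by move=> s; rewrite in_itv /= => /andP[/ltW ? /ltW ?]; apply: dg; apply/andP.
- apply: derivable_within_continuous => s; rewrite in_itv /= => hs.
  by have := dg s hs.
move: shI; rewrite in_itv /= => /andP[/ltW s0 /ltW sh].
have hs : 0 <= s <= h by rewrite s0.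
have dk (t : R) : 0 <= t <= h ->
    is_derive t 1 (fun t => 'D_u F (x + s *: u + t *: v))
      ('D_v ('D_u F) (x + s *: u + t *: v)).
  move=> ht; apply: is_derive_line.
  exact: smooth_derivable (smooth_derive _ sF) (hA _ _ hs ht).
have [||t thI kE] := @MVT _ (fun t => 'D_u F (x + s *: u + t *: v))
    (fun t => 'D_v ('D_u F) (x + s *: u + t *: v)) 0 h h0.
- by move=> t; rewrite in_itv /= => /andP[/ltW ? /ltW ?]; apply: dk; apply/andP.
- apply: derivable_within_continuous => t; rewrite in_itv /= => ht.
  by have := dk t ht.
move: thI; rewrite in_itv /= => /andP[/ltW t0 /ltW th].
exists s, t; split=> //; first by rewrite t0.
move: gE kE; rewrite /g !scale0r !addr0 !subr0 => gE kE.
rewrite -mulrA [h * 'D_v _ _]mulrC -kE mulrC.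
rewrite addrAC -[x + s *: u + h *: v]addrAC -gE.
by rewrite [x + h *: v + h *: u]addrAC; ring.
Qed.

Lemma derive_comm A F (x u v : E) : open A -> smooth_on A F -> A x ->
  'D_u ('D_v F) x = 'D_v ('D_u F) x.
Proof.
move=> oA sF Ax; apply/eqP; rewrite -subr_eq0 -normr_le0.
apply/ler_addgt0Pl => e e0; rewrite addr0.
pose a := 'D_u ('D_v F); pose b := 'D_v ('D_u F).
have ca : {for x, continuous a}.
  apply: differentiable_continuous.
  exact: smooth_differentiable (smooth_derive _ (smooth_derive _ sF)) Ax.
have cb : {for x, continuous b}.
  apply: differentiable_continuous.
  exact: smooth_differentiable (smooth_derive _ (smooth_derive _ sF)) Ax.
have e20 : 0 < e / 2 by rewrite divr_gt0.
have {}ca : \forall y \near x, `|a x - a y| < e / 2.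
  by move/cvgrPdist_lt : ca => /(_ _ e20).
have {}cb : \forall y \near x, `|b x - b y| < e / 2.
  by move/cvgrPdist_lt : cb => /(_ _ e20).
have : \forall y \near x, [/\ A y, `|a x - a y| < e / 2 & `|b x - b y| < e / 2].
  have nA : \forall y \near x, A y by exact: open_nbhs_nbhs.
  by apply: filterS (filterI nA (filterI ca cb)) => y [? []].
move=> /nbhs_ballP[d /= d0 dP].
have m0 : 0 < `|u| + `|v| + 1 by rewrite ltr_wpDl ?addr_ge0.
(* Keeps the parallelogram with sides h u and h v inside the ball of radius d; the summand 1 covers
   u = v = 0. *)
pose h := d / 2 / (`|u| + `|v| + 1).
have h0 : 0 < h by rewrite !divr_gt0.
have near_x (s t : R) : 0 <= s <= h -> 0 <= t <= h -> ball x d (x + s *: u + t *: v).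
  move=> /andP[s0 sh] /andP[t0 th].
  rewrite -ball_normE /ball_ /= -addrA opprD addNKr normrN.
  apply: le_lt_trans (ler_normD _ _) _; rewrite !normrZ !ger0_norm //.
  apply: (@le_lt_trans _ _ (h * (`|u| + `|v|))).
    by rewrite mulrDr lerD // ler_wpM2r.
  apply: (@lt_trans _ _ (h * (`|u| + `|v| + 1))).
    by rewrite ltr_pM2l // ltrDl.
  by rewrite /h divfK ?gt_eqF //; lra.
have HA (s t : R) : 0 <= s <= h -> 0 <= t <= h -> A (x + s *: u + t *: v).
  by move=> hs ht; have [] := dP _ (near_x _ _ hs ht).
have HA' (s t : R) : 0 <= s <= h -> 0 <= t <= h -> A (x + s *: v + t *: u).
  by move=> hs ht; rewrite addrAC; exact: HA.
have [s [t [hs ht E1]]] := second_difference_mean sF h0 HA.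
have [s' [t' [hs' ht' E2]]] := second_difference_mean sF h0 HA'.
have {E1 E2} E12 : b (x + s *: u + t *: v) = a (x + s' *: v + t' *: u).
  have hh : h * h != 0 by rewrite mulf_neq0 // gt_eqF.
  apply: (mulfI hh); rewrite -/b in E1; rewrite -/a in E2; rewrite -E1 -E2.
  by rewrite [x + h *: v + h *: u]addrAC; ring.
have [_ _ Hb] := dP _ (near_x _ _ hs ht).
have [_ + _] := dP _ (near_x _ _ ht' hs'); rewrite addrAC -E12 => Ha.
rewrite -/a -/b; rewrite distrC in Hb.
have -> : a x - b x = (a x - b (x + s *: u + t *: v)) +
    (b (x + s *: u + t *: v) - b x) by ring.
apply: le_trans (ler_normD _ _) _; rewrite [leRHS]splitr.
exact: (lerD (ltW Ha) (ltW Hb)).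
Qed.

End Schwarz.

(** * The sphere and homogeneous functions *)

Section DotProduct.
Context {R : realType} {m : nat}.
Implicit Types u v w : 'rV[R]_m.

Lemma dotC u v : dot u v = dot v u.
Proof. by apply: eq_bigr => i _; rewrite mulrC. Qed.

Lemma dotDl u v w : dot (u + v) w = dot u w + dot v w.
Proof. by rewrite /dot -big_split; apply: eq_bigr => i _; rewrite !mxE mulrDl. Qed.

Lemma dotDr u v w : dot w (u + v) = dot w u + dot w v.
Proof. by rewrite dotC dotDl !(dotC w). Qed.

Lemma dotZl (a : R) u v : dot (a *: u) v = a * dot u v.
Proof. by rewrite /dot mulr_sumr; apply: eq_bigr => i _; rewrite !mxE mulrA. Qed.

Lemma dotZr (a : R) u v : dot u (a *: v) = a * dot u v.
Proof. by rewrite dotC dotZl dotC. Qed.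

Lemma dotNl u v : dot (- u) v = - dot u v.
Proof. by rewrite -scaleN1r dotZl mulN1r. Qed.

Lemma dotNr u v : dot v (- u) = - dot v u.
Proof. by rewrite dotC dotNl dotC. Qed.

Lemma dot0l v : dot 0 v = 0.
Proof. by rewrite -(scale0r v) dotZl mul0r. Qed.

Lemma dot_ge0 u : 0 <= dot u u.
Proof. by apply: sumr_ge0 => i _; rewrite -expr2 sqr_ge0. Qed.

Lemma dot_gt0 u : (0 < dot u u) = (u != 0).
Proof. by rewrite lt_neqAle dot_ge0 andbT eq_sym dot_eq0. Qed.

Lemma enorm_ge0 u : 0 <= enorm u.
Proof. exact: sqrtr_ge0. Qed.

Lemma enorm_gt0 u : (0 < enorm u) = (u != 0).
Proof. by rewrite sqrtr_gt0 dot_gt0. Qed.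

Lemma enorm_sqr u : enorm u ^+ 2 = dot u u.
Proof. by rewrite sqr_sqrtr ?dot_ge0. Qed.

Lemma enormZ (r : R) u : 0 <= r -> enorm (r *: u) = r * enorm u.
Proof.
move=> r0; rewrite /enorm dotZl dotZr mulrA -expr2 sqrtrM ?sqr_ge0 //.
by rewrite sqrtr_sqr ger0_norm.
Qed.

Lemma dot_suml k (c : 'I_k -> R) (u : 'I_k -> 'rV[R]_m) v :
  dot (\sum_i c i *: u i) v = \sum_i c i * dot (u i) v.
Proof.
elim: k c u => [|k IH] c u; first by rewrite !big_ord0 dot0l.
by rewrite !big_ord_recl dotDl dotZl IH.
Qed.

Lemma dot_mulmx_orthogonal (Q : 'M[R]_m) u v : Q *m Q^T = 1%:M ->
  dot (u *m Q) (v *m Q) = dot u v.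
Proof. by move=> QQ; rewrite !dotE trmx_mul mulmxA -(mulmxA u) QQ mulmx1. Qed.

End DotProduct.

Section SphereNorm.
Context {R : realType} {n : nat}.
Local Notation E := 'rV[R]_n.+1.
Local Notation punctured := [set y : E | y != 0].
Implicit Types (A : set E) (F G : E -> R).

Lemma sphere_neq0 (x : E) : sphere R n x -> x != 0.
Proof. by rewrite /sphere /= => x1; rewrite -dot_gt0 x1 ltr01. Qed.

Lemma enorm_sphere (x : E) : sphere R n x -> enorm x = 1.
Proof. by rewrite /sphere /enorm /= => ->; rewrite sqrtr1. Qed.

Lemma sphere_normalize (y : E) : y != 0 -> sphere R n ((enorm y)^-1 *: y).
Proof.
rewrite -enorm_gt0 => y0; rewrite /sphere /= dotZl dotZr -enorm_sqr.
by field; rewrite gt_eqF.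
Qed.

Lemma rext_sphere {T} (F : E -> T) (x : E) : sphere R n x -> rext F x = F x.
Proof. by move=> x1; rewrite /rext enorm_sphere // invr1 scale1r. Qed.

Lemma open_punctured : open punctured.
Proof.
rewrite (_ : punctured = ~` [set 0]).
  by rewrite openC; exact: accessible_closed_set1 (@hausdorff_accessible _ (@norm_hausdorff _ _)) _.
by apply/seteqP; split => y /= /eqP.
Qed.
Hint Resolve open_punctured : core.

Lemma differentiable_coordinate i (y : E) : differentiable (fun y : E => y 0 i) y.
Proof. exact: differentiable_coord. Qed.

Lemma derive_coordinate i (v y : E) : 'D_v (fun y : E => y 0 i) y = v 0 i.
Proof.
have dv : derivable (fun y : E => (y : 'M[R]_(1, n.+1))) y v by exact: derivable_id.
have := derive_mx dv; rewrite [LHS]derive_id => h.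
by rewrite [in RHS]h mxE.
Qed.

Lemma smooth_coordinate A i : open A -> smooth_on A (fun y : E => y 0 i).
Proof.
move=> oA; apply/smooth_onP => -[|k].
  by split=> // x _; exact: differentiable_coordinate.
split=> [x _|v]; first exact: differentiable_coordinate.
apply: (diff_upto_eq (F := cst (v 0 i))) => //.
  by move=> y _; rewrite derive_coordinate.
by move: k; apply/smooth_onP; exact: smooth_cst.
Qed.

Lemma smooth_dotr A (w : E) : open A -> smooth_on A (fun y : E => dot y w).
Proof.
move=> oA; apply: smooth_sum => // i.
by apply: smoothM => //; [exact: smooth_coordinate | exact: smooth_cst].
Qed.

Lemma smooth_dot_self A : open A -> smooth_on A (fun y : E => dot y y).
Proof.
by move=> oA; apply: smooth_sum => // i; apply: smoothM => //; exact: smooth_coordinate.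
Qed.

Lemma derive_dotr (v w y : E) : 'D_v (fun y : E => dot y w) y = dot v w.
Proof.
rewrite /dot; have dC i : derivable (fun y : E => y 0 i * w 0 i) y v.
  apply: smooth_derivable (_ : smooth_on setT _) _ => //; apply: smoothM => //.
  - exact: openT. - exact: smooth_coordinate openT. - exact: smooth_cst.
rewrite (_ : (fun _ => _) = \sum_i (fun y : E => y 0 i * w 0 i)); last first.
  by apply/funext => z; rewrite fct_sumE.
rewrite derive_sum //; apply: eq_bigr => i _.
rewrite (@deriveM _ _ (fun y : E => y 0 i) (cst (w 0 i))); last 2 first.
- exact: diff_derivable (differentiable_coordinate _ _).
- exact: derivable_cst.
by rewrite derive_cst derive_coordinate scaler0 add0r /GRing.scale /= mulrC.
Qed.

Lemma derive_dot_self (v y : E) : 'D_v (fun y : E => dot y y) y = 2 * dot y v.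
Proof.
have dC i : derivable (fun y : E => y 0 i * y 0 i) y v.
  apply: diff_derivable; apply: differentiableM; exact: differentiable_coordinate.
rewrite /dot (_ : (fun _ => _) = \sum_i (fun y : E => y 0 i * y 0 i)); last first.
  by apply/funext => z; rewrite fct_sumE.
rewrite derive_sum // mulr_sumr; apply: eq_bigr => i _.
rewrite (@deriveM _ _ (fun y : E => y 0 i) (fun y : E => y 0 i)); last 2 first.
- exact: diff_derivable (differentiable_coordinate _ _).
- exact: diff_derivable (differentiable_coordinate _ _).
by rewrite derive_coordinate /GRing.scale /=; ring.
Qed.

Lemma differentiable_enorm (y : E) : y != 0 -> differentiable (@enorm R n.+1) y.
Proof.
move=> y0; apply: (@differentiable_comp _ _ _ _ (fun y : E => dot y y) Num.sqrt).
  by apply: (smooth_differentiable (smooth_dot_self openT)).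
by apply/derivable1_diffP; have := @is_derive1_sqrt R (dot y y); rewrite dot_gt0 => /(_ y0).
Qed.

Lemma derive_enorm (v y : E) : y != 0 -> 'D_v enorm y = dot y v / enorm y.
Proof.
move=> y0; have dN : derivable enorm y v by exact: diff_derivable (differentiable_enorm y0).
have := derive_dot_self v y.
have -> : (fun y : E => dot y y) = enorm * enorm.
  by apply/funext => z; rewrite -enorm_sqr expr2.
rewrite deriveM // /GRing.scale /= => h.
have N0 : enorm y != 0 by rewrite gt_eqF // enorm_gt0.
by apply: (mulfI N0); rewrite mulrCA mulfV // mulr1; lra.
Qed.

(** The induction runs on 1/|y| and not on |y|: its derivative -(y.v) (1/|y|)^3 is a polynomial in y
    and 1/|y| itself. The norm comes back as |y|^2 times 1/|y|. *)
Lemma smooth_enorm : smooth_on punctured enorm.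
Proof.
pose I := fun y : E => (enorm y)^-1.
have dI k : diff_upto k punctured I.
  elim: k => [|k IH].
    split=> // x x0; apply: differentiableV; last by rewrite gt_eqF ?enorm_gt0.
    exact: differentiable_enorm.
  split=> [x|v]; first exact: diff_upto_differentiable IH.
  apply: (diff_upto_eq (F := (fun y => dot y (- v)) \* (I \* (I \* I)))) => //.
    move=> y y0 /=; have N0 : enorm y != 0 by rewrite gt_eqF // enorm_gt0.
    rewrite deriveV ?derive_enorm //.
      by rewrite dotNr /I /GRing.scale /=; field.
    exact/diff_derivable/differentiable_enorm.
  apply: diff_uptoM => //; last by do 2 apply: diff_uptoM => //.
  by move: k {IH}; apply/smooth_onP; exact: smooth_dotr.
apply: (smooth_eq_on (F := (fun y => dot y y) \* I)) => //.
  move=> y y0 /=; have N0 : enorm y != 0 by rewrite gt_eqF // enorm_gt0.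
  by rewrite -enorm_sqr /I; field.
by apply: smoothM => //; [exact: smooth_dot_self | exact/smooth_onP].
Qed.

End SphereNorm.

#[global] Hint Resolve open_punctured : core.

(** * Homogeneous functions and Euler's relation *)

Section Homogeneity.
Context {R : realType} {n : nat}.
Local Notation E := 'rV[R]_n.+1.
Local Notation punctured := [set y : E | y != 0].
Implicit Types (F G : E -> R) (k : int).

Definition homog k F := forall r (y : E), 0 < r -> y != 0 -> F (r *: y) = r ^ k * F y.

Lemma homog_enorm : homog 1 enorm.
Proof. by move=> r y r0 _; rewrite enormZ ?ltW. Qed.

Lemma homog_rext (F : E -> R) : homog 0 (rext F).
Proof.
move=> r y r0 y0; rewrite expr0z mul1r /rext enormZ ?ltW // invfM scalerA.
by rewrite mulrAC mulVf ?gt_eqF // mul1r.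
Qed.

Lemma homogM k k' F G : homog k F -> homog k' G -> homog (k + k') (F \* G).
Proof.
move=> hF hG r y r0 y0; rewrite /= hF // hG // expfzDr ?gt_eqF //; ring.
Qed.

Lemma homog_derive k F v : smooth_on punctured F -> homog k F ->
  homog (k - 1) ('D_v F).
Proof.
move=> sF hF r y r0 y0; have rn0 : r != 0 by rewrite gt_eqF.
have ry0 : r *: y != 0 by rewrite scaler_eq0 negb_or rn0.
have : 'D_v (fun z => F (r *: z)) y = r * 'D_v F (r *: y).
  transitivity ('D_(r *: v) F (r *: y)); last first.
    by rewrite -[X in 'D_X _ _]addr0 (derive_linear r v 0 sF ry0) derive0 addr0.
  have e : (fun h : R => h^-1 *: (((fun z => F (r *: z)) \o shift y) (h *: v) -
        F (r *: y))) =
      (fun h : R => h^-1 *: ((F \o shift (r *: y)) (h *: (r *: v)) - F (r *: y))).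
    by apply/funext => h /=; congr (_ *: (F _ - _)); rewrite scalerDr !scalerA [h * r]mulrC.
  by rewrite /derive e.
rewrite (@derive_eq_on _ _ punctured _ (fun z => r ^ k *: F z)) //; last by move=> z z0; exact: hF.
rewrite deriveZ; last exact: smooth_derivable sF _.
rewrite expfzDr // exprN1 /GRing.scale /= => h.
by apply: (mulfI rn0); rewrite -h; field.
Qed.

Lemma homog_euler k F (x : E) : smooth_on punctured F -> homog k F -> x != 0 ->
  'D_x F x = k%:~R * F x.
Proof.
move=> sF hF x0.
have h1 : is_derive (0 : R) 1 (fun t => F (x + t *: x)) ('D_x F x).
  have := @is_derive_line _ _ F x x 0; rewrite scale0r addr0; apply.
  exact: smooth_derivable sF _.
have hp : is_derive (0 : R) 1 (fun t : R => (1 + t) ^ k) k%:~R.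
  have hX m : is_derive (0 : R) 1 (fun t : R => (1 + t) ^+ m) m%:R.
    rewrite (_ : (fun t : R => (1 + t) ^+ m) = (fun t : R => 1 + t) ^+ m); last first.
      by rewrite exprfctE.
    have h : is_derive (0 : R) 1 (fun t : R => 1 + t) 1.
      have := is_deriveD (is_derive_cst (1 : R) (0 : R) 1) (is_derive_id (0 : R) 1).
      by rewrite add0r.
    apply: is_derive_eq (is_deriveX m h) _.
    by rewrite addr0 expr1n mulr1 [LHS]mulr1.
  case: k {hF} => m; first exact: hX.
  have := @is_deriveV _ (fun t : R => (1 + t) ^+ m.+1) 0 m.+1%:R 1.
  rewrite addr0 expr1n oner_neq0 => /(_ isT (hX _)) => h.
  apply: is_derive_eq h _.
  by rewrite expr1n invr1 NegzE rmorphN /= scaleN1r.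
have h2 : is_derive (0 : R) 1 (fun t => F (x + t *: x)) (k%:~R * F x).
  apply: (@near_eq_is_derive _ _ _ (fun t : R => F x *: (1 + t) ^ k)).
    have ray (t : R) : - t < 1 -> F x *: (1 + t) ^ k = F (x + t *: x).
      move=> t1; have -> : x + t *: x = (1 + t) *: x by rewrite scalerDl scale1r.
      by rewrite hF // -?ltrBlDr ?sub0r // [LHS]mulrC.
    apply: filterS ray _; apply: Nlt_nbhsl; rewrite oppr0; exact: ltr01.
  by apply: is_derive_eq; rewrite /GRing.scale /= mulrC.
by rewrite -(@derive_val _ _ _ _ _ _ _ h1) (@derive_val _ _ _ _ _ _ _ h2).
Qed.

End Homogeneity.

(** * Laplacian and squared gradient in an arbitrary orthonormal basis *)

Section AmbientTraces.
Context {R : realType} {n : nat}.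
Local Notation E := 'rV[R]_n.+1.
Local Notation e_ j := (delta_mx 0 j : E).
Implicit Types (A : set E) (F G : E -> R) (u v w x y : E).

Lemma derive_basis A F w y : smooth_on A F -> A y ->
  'D_w F y = \sum_j w 0 j * 'D_(e_ j) F y.
Proof. by move=> sF Ay; rewrite {1}[w]row_sum_delta; exact: derive_sumv sF Ay. Qed.

Lemma derive_dot A F w y : smooth_on A F -> A y ->
  'D_w F y = dot w (\row_j 'D_(e_ j) F y).
Proof.
move=> sF Ay; rewrite (derive_basis w sF Ay).
by apply: eq_bigr => j _; rewrite mxE.
Qed.

Lemma derive2_sum A F u v y : open A -> smooth_on A F -> A y ->
  'D_u ('D_v F) y =
    (u *m (\matrix_(j, k) 'D_(e_ j) ('D_(e_ k) F) y) *m v^T) 0 0.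
Proof.
move=> oA sF Ay; rewrite (derive_basis u (smooth_derive v sF) Ay) -mulmxA mxE.
apply: eq_bigr => j _; congr (_ * _).
rewrite (derive_comm (e_ j) v oA sF Ay).
rewrite (derive_basis v (smooth_derive (e_ j) sF) Ay) mxE.
apply: eq_bigr => k _; rewrite [v^T _ _]mxE [X in _ = X * _]mxE mulrC.
by rewrite (derive_comm (e_ k) (e_ j) oA sF Ay).
Qed.

Lemma derive2_linearl A F a u u' v y : smooth_on A F -> A y ->
  'D_(a *: u + u') ('D_v F) y = a * 'D_u ('D_v F) y + 'D_u' ('D_v F) y.
Proof. by move=> sF; apply: derive_linear; exact: smooth_derive. Qed.

Lemma derive2_linearr A F a u v v' y : open A -> smooth_on A F -> A y ->
  'D_u ('D_(a *: v + v') F) y = a * 'D_u ('D_v F) y + 'D_u ('D_v' F) y.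
Proof.
move=> oA sF Ay; rewrite (derive_comm u (a *: v + v') oA sF Ay) (derive2_linearl a v v' u sF Ay).
by rewrite (derive_comm v u oA sF Ay) (derive_comm v' u oA sF Ay).
Qed.

Definition ambient_lap F y : R := \sum_j 'D_(e_ j) ('D_(e_ j) F) y.

Definition grad_sqr F y : R := \sum_j ('D_(e_ j) F y) ^+ 2.

Lemma ambient_lap_orthonormal A F (Q : 'M[R]_n.+1) y :
  open A -> smooth_on A F -> A y -> Q^T *m Q = 1%:M ->
  ambient_lap F y = \sum_i 'D_(row i Q) ('D_(row i Q) F) y.
Proof.
move=> oA sF Ay QQ; set M := (\matrix_(j, k) 'D_(e_ j) ('D_(e_ k) F) y : 'M[R]_n.+1).
transitivity (\tr M); first by apply: eq_bigr => j _; rewrite mxE.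
rewrite -[M]mulmx1 -QQ mulmxA mxtrace_mulC mulmxA.
apply: eq_bigr => i _; rewrite (derive2_sum (row i Q) (row i Q) oA sF Ay) -/M.
rewrite -row_mul [LHS]mxE [RHS]mxE; apply: eq_bigr => j _.
by rewrite [in RHS]mxE; congr (_ * _); rewrite !mxE.
Qed.

Lemma grad_sqr_orthonormal A F (Q : 'M[R]_n.+1) y :
  smooth_on A F -> A y -> Q^T *m Q = 1%:M ->
  grad_sqr F y = \sum_i ('D_(row i Q) F y) ^+ 2.
Proof.
move=> sF Ay QQ; set g := (\row_j 'D_(e_ j) F y : E).
transitivity (dot g g); first by apply: eq_bigr => j _; rewrite mxE expr2.
rewrite -(dot_mulmx_orthogonal (Q := Q^T)) ?trmxK //.
apply: eq_bigr => i _; rewrite (derive_dot (row i Q) sF Ay) -/g expr2.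
have -> : (g *m Q^T) 0 i = dot (row i Q) g; last by [].
by rewrite mxE; apply: eq_bigr => j _; rewrite !mxE mulrC.
Qed.

End AmbientTraces.

Section TangentFrame.
Context {R : realType} {n : nat}.
Local Notation E := 'rV[R]_n.+1.
Implicit Types (v w x y : E) (c : 'rV[R]_n).

Lemma householder_orthogonal x : (householder x)^T *m householder x = 1%:M.
Proof. by rewrite householder_sym householderK. Qed.

Lemma sum_row_householder (V : nmodType) x (T : E -> V) : sphere R n x ->
  \sum_i T (row i (householder x)) = T x + \sum_a T (frame x a).
Proof. by move=> x1; rewrite big_ord_recl row0_householder. Qed.

Definition tang x c : E := \sum_a c 0 a *: frame x a.

Lemma dot_tang_frame x c a : dot (tang x c) (frame x a) = c 0 a.
Proof.
rewrite dot_suml (bigD1 a) //= frame_orthonormal eqxx mulr1 big1 ?addr0 // => b ba.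
by rewrite frame_orthonormal (negbTE ba) mulr0.
Qed.

Lemma dot_tang x c c' : dot (tang x c) (tang x c') = dot c c'.
Proof.
rewrite dotC dot_suml; apply: eq_bigr => a _.
by rewrite dotC dot_tang_frame mulrC.
Qed.

Lemma dot_tang_base x c : sphere R n x -> dot (tang x c) x = 0.
Proof.
by move=> x1; rewrite dot_suml big1 // => a _; rewrite frame_tangent // mulr0.
Qed.

Lemma tang_decomp x w : sphere R n x ->
  w = dot w x *: x + tang x (\row_a dot w (frame x a)).
Proof.
move=> x1; pose Q := householder x.
have wE : w = \sum_i dot w (row i Q) *: row i Q.
  rewrite -{1}[w]mulmx1 -(householder_orthogonal x) mulmxA mulmx_sum_row.
  apply: eq_bigr => i _; congr (_ *: _).
  by rewrite mxE; apply: eq_bigr => j _; rewrite !mxE.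
rewrite {1}wE (sum_row_householder (fun u => dot w u *: u) x1); congr (_ + _).
by apply: eq_bigr => a _; rewrite mxE.
Qed.

End TangentFrame.

(** * Covariant derivatives on the sphere as ambient derivatives of the radial extension *)

Section CovariantHessian.
Context {R : realType} {n : nat}.
Local Notation E := 'rV[R]_n.+1.
Local Notation punctured := [set y : E | y != 0].
Local Notation e_ j := (delta_mx 0 j : E).
Variable f : E -> R.
Hypothesis f_smooth : smooth_on_sphere f.

Lemma homog_derive_rext v : homog (- 1) ('D_v (rext f)).
Proof.
by have := homog_derive v f_smooth (homog_rext f); rewrite sub0r.
Qed.

Lemma rext_gradE y j : y != 0 ->
  (rext (grad f) y) 0 j = enorm y * 'D_(e_ j) (rext f) y.
Proof.
move=> y0; rewrite /rext /grad mxE.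
have N0 : 0 < enorm y by rewrite enorm_gt0.
rewrite (homog_derive_rext (e_ j)) ?invr_gt0 //.
by rewrite exprN1 invrK.
Qed.

(** The factor |y| in [rext_gradE] is stationary at x in tangential directions and equals 1 there,
    so only the ambient partial derivative gets differentiated. *)
Lemma derive_rext_grad x v j : sphere R n x -> dot v x = 0 ->
  derivable (rext (grad f)) x v /\
  ('D_v (rext (grad f)) x) 0 j = 'D_v ('D_(e_ j) (rext f)) x.
Proof.
move=> x1 vx; have x0 := sphere_neq0 x1.
have dG k : is_derive x v (fun y => (rext (grad f) y) 0 k) ('D_v ('D_(e_ k) (rext f)) x).
  apply: (@near_eq_is_derive _ _ _ (enorm * 'D_(e_ k) (rext f))).
    have : \forall y \near x, y != 0.
      exact: (open_nbhs_nbhs (conj open_punctured x0)).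
    by apply: filterS => y y0; rewrite rext_gradE.
  have dN : is_derive x v enorm 0.
    apply: DeriveDef; first exact: diff_derivable (differentiable_enorm x0).
    by rewrite derive_enorm // dotC vx mul0r.
  have dF : is_derive x v ('D_(e_ k) (rext f)) ('D_v ('D_(e_ k) (rext f)) x).
    apply: DeriveDef => //.
    exact: smooth_derivable (smooth_derive _ f_smooth) x0.
  apply: is_derive_eq.
  by rewrite enorm_sphere // scale1r scaler0 addr0.
have dm : derivable (rext (grad f)) x v.
  by apply/derivable_mxP => i k; rewrite ord1; have := dG k.
split=> //; rewrite derive_mx // mxE.
exact: (@derive_val _ _ _ _ _ _ _ (dG j)).
Qed.

Lemma hessE x a b : sphere R n x ->
  hess f x a b = 'D_(frame x a) ('D_(frame x b) (rext f)) x.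
Proof.
move=> x1; have x0 := sphere_neq0 x1.
rewrite mxE /covder dotDl dotNl dotZl [dot x _]dotC !frame_tangent // mulr0 subr0.
rewrite (derive_comm (frame x a) (frame x b) open_punctured f_smooth x0).
rewrite (derive_basis (frame x b) (smooth_derive (frame x a) f_smooth) x0).
rewrite dotC; apply: eq_bigr => j _; congr (_ * _).
rewrite (derive_rext_grad j x1 (frame_tangent a x1)).2.
exact: derive_comm open_punctured f_smooth x0.
Qed.

Lemma hess_quadratic x c : sphere R n x ->
  dot (c *m hess f x) c = 'D_(tang x c) ('D_(tang x c) (rext f)) x.
Proof.
move=> x1; have x0 := sphere_neq0 x1.
have -> : 'D_(tang x c) ('D_(tang x c) (rext f)) x =
    \sum_a c 0 a * 'D_(frame x a) ('D_(tang x c) (rext f)) x.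
  exact: derive_sumv (smooth_derive (tang x c) f_smooth) x0.
rewrite dotC; apply: eq_bigr => a _; congr (_ * _).
rewrite (derive_comm (frame x a) (tang x c) open_punctured f_smooth x0).
have -> : 'D_(tang x c) ('D_(frame x a) (rext f)) x =
    \sum_b c 0 b * 'D_(frame x b) ('D_(frame x a) (rext f)) x.
  exact: derive_sumv (smooth_derive (frame x a) f_smooth) x0.
by rewrite mxE; apply: eq_bigr => b _; congr (_ * _); exact: hessE.
Qed.

Lemma derive_rext_radial x : x != 0 -> 'D_x (rext f) x = 0.
Proof. by move=> x0; rewrite (homog_euler f_smooth (homog_rext f) x0) mul0r. Qed.

Lemma enorm_grad_sqr x : sphere R n x -> enorm (grad f x) ^+ 2 = grad_sqr (rext f) x.
Proof. by rewrite enorm_sqr => _; apply: eq_bigr => j _; rewrite mxE expr2. Qed.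

Lemma enorm_grad_frame x : sphere R n x ->
  enorm (grad f x) ^+ 2 = \sum_a ('D_(frame x a) (rext f) x) ^+ 2.
Proof.
move=> x1; have x0 := sphere_neq0 x1; rewrite enorm_grad_sqr //.
rewrite (grad_sqr_orthonormal f_smooth x0 (householder_orthogonal x)).
rewrite (sum_row_householder (fun u => ('D_u (rext f) x) ^+ 2) x1).
by rewrite derive_rext_radial // expr0n add0r.
Qed.

Lemma laplacianE x : sphere R n x ->
  laplacian f x = \sum_a 'D_(frame x a) ('D_(frame x a) (rext f)) x.
Proof. by move=> x1; apply: eq_bigr => a _; exact: hessE. Qed.

End CovariantHessian.

(** * The homogeneous extension of phi *)

Section Support.
Context {R : realType} {n : nat}.
Local Notation E := 'rV[R]_n.+1.
Local Notation punctured := [set y : E | y != 0].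
Local Notation e_ j := (delta_mx 0 j : E).
Variable phi : E -> R.
Hypothesis phi_smooth : smooth_on_sphere phi.
Local Notation F := (rext phi).

Definition hsupport (y : E) : R := enorm y * F y.
Local Notation H := hsupport.
Implicit Types u v w x y : E.

Lemma smooth_support : smooth_on punctured H.
Proof. by apply: smoothM => //; exact: smooth_enorm. Qed.
Local Notation sH := smooth_support.

Lemma homog_support : homog 1 H.
Proof. by have := homogM homog_enorm (homog_rext phi); rewrite addr0. Qed.

Lemma homog_derive_support u : homog 0 ('D_u H).
Proof. by have := homog_derive u sH homog_support; rewrite subrr. Qed.

Lemma homog_derive2_support u v : homog (- 1) ('D_u ('D_v H)).
Proof.
by have := homog_derive u (smooth_derive v sH) (homog_derive_support v); rewrite sub0r.
Qed.

Lemma homog_derive3_support u v w : homog (- 2) ('D_u ('D_v ('D_w H))).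
Proof.
by have := homog_derive u (smooth_derive v (smooth_derive w sH)) (homog_derive2_support v w).
Qed.

Lemma support_sphere x : sphere R n x -> H x = phi x.
Proof. by move=> x1; rewrite /H enorm_sphere // mul1r rext_sphere. Qed.

Lemma support_polar y : y != 0 -> H y = enorm y * phi ((enorm y)^-1 *: y).
Proof. by []. Qed.

Lemma derive_support v y : y != 0 ->
  'D_v H y = enorm y * 'D_v F y + F y * (dot y v / enorm y).
Proof.
move=> y0; rewrite -(derive_enorm v y0).
rewrite [LHS](@deriveM _ _ enorm F) //.
  exact: diff_derivable (differentiable_enorm y0).
exact: smooth_derivable phi_smooth y0.
Qed.

Lemma derive_support_sphere v x : sphere R n x ->
  'D_v H x = 'D_v F x + phi x * dot x v.
Proof.
move=> x1; rewrite (derive_support v (sphere_neq0 x1)) enorm_sphere //.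
by rewrite mul1r divr1 rext_sphere.
Qed.

(** Of the Leibniz terms of [derive_support] only two survive: |y| and 1/|y| are stationary in the
    tangential direction u, and y.v vanishes at x. *)
Lemma derive2_support_sphere u v x : sphere R n x -> dot u x = 0 -> dot v x = 0 ->
  'D_u ('D_v H) x = 'D_u ('D_v F) x + phi x * dot u v.
Proof.
move=> x1 ux vx; have x0 := sphere_neq0 x1.
pose I (y : E) : R := (enorm y)^-1; pose d (y : E) : R := dot y v.
rewrite (derive_eq_on (G := (enorm \* 'D_v F) \+ (F \* (d \* I))) u open_punctured x0); last first.
  by move=> y y0; exact: derive_support.
have dN : is_derive x u enorm 0.
  apply: DeriveDef; first exact: diff_derivable (differentiable_enorm x0).
  by rewrite derive_enorm // dotC ux mul0r.
have dI : is_derive x u I 0.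
  have N0 : enorm x != 0 by rewrite enorm_sphere // oner_neq0.
  apply: DeriveDef; first by apply: derivableV => //; exact: ex_derive.
  by rewrite deriveV // (@derive_val _ _ _ _ _ _ _ dN) scaler0.
have dF : is_derive x u F ('D_u F x).
  by apply: DeriveDef => //; exact: smooth_derivable phi_smooth x0.
have dF' : is_derive x u ('D_v F) ('D_u ('D_v F) x).
  apply: DeriveDef => //; exact: smooth_derivable (smooth_derive v phi_smooth) x0.
have dd : is_derive x u d (dot u v).
  apply: DeriveDef; last exact: derive_dotr.
  exact: smooth_derivable (smooth_dotr v openT) _.
have := is_deriveD (is_deriveM dN dF') (is_deriveM dF (is_deriveM dd dI)).
move=> /(@derive_val _ _ _ _ _ _ _) ->.
rewrite !fctE /I /d [dot x v]dotC vx enorm_sphere // rext_sphere // invr1.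
by rewrite /GRing.scale /=; ring.
Qed.

Lemma derive_support_radial x : sphere R n x -> 'D_x H x = phi x.
Proof.
by move=> x1; rewrite (homog_euler sH homog_support (sphere_neq0 x1)) mul1r support_sphere.
Qed.

Lemma derive2_support_radial u x : x != 0 -> 'D_x ('D_u H) x = 0.
Proof.
by move=> x0; rewrite (homog_euler (smooth_derive u sH) (homog_derive_support u) x0) mul0r.
Qed.

Lemma derive2_support_radialr u x : x != 0 -> 'D_u ('D_x H) x = 0.
Proof.
by move=> x0; rewrite (derive_comm u x open_punctured sH x0) derive2_support_radial.
Qed.

Lemma derive3_support_radial u v x : x != 0 ->
  'D_x ('D_u ('D_v H)) x = - 'D_u ('D_v H) x.
Proof.
move=> x0; rewrite (homog_euler (smooth_derive u (smooth_derive v sH))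
  (homog_derive2_support u v) x0).
by rewrite rmorphN /= mulN1r.
Qed.

Lemma derive4_support_radial u v x : x != 0 ->
  'D_x ('D_x ('D_u ('D_v H))) x = 2 * 'D_u ('D_v H) x.
Proof.
move=> x0; rewrite (homog_euler (smooth_derive x (smooth_derive u (smooth_derive v sH)))
  (homog_derive3_support x u v) x0) derive3_support_radial //.
by rewrite rmorphN /= mulNr mulrN opprK.
Qed.

Lemma grad_sqr_support_sphere x : sphere R n x ->
  grad_sqr H x = enorm (grad phi x) ^+ 2 + phi x ^+ 2.
Proof.
move=> x1; have x0 := sphere_neq0 x1.
rewrite (grad_sqr_orthonormal sH x0 (householder_orthogonal x)).
rewrite (sum_row_householder (fun u => ('D_u H x) ^+ 2) x1).
rewrite derive_support_radial // addrC (enorm_grad_frame phi_smooth x1).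
congr (_ + _); apply: eq_bigr => a _.
by rewrite derive_support_sphere // [dot x _]dotC frame_tangent // mulr0 addr0.
Qed.

Lemma lap_support_sphere x : sphere R n x ->
  ambient_lap H x = laplacian phi x + n%:R * phi x.
Proof.
move=> x1; have x0 := sphere_neq0 x1.
rewrite (ambient_lap_orthonormal open_punctured sH x0 (householder_orthogonal x)).
rewrite (sum_row_householder (fun u => 'D_u ('D_u H) x) x1).
rewrite derive2_support_radial // add0r (laplacianE phi_smooth x1).
have -> : n%:R * phi x = \sum_(a < n) phi x.
  by rewrite sumr_const card_ord mulr_natl.
rewrite -big_split; apply: eq_bigr => a _ /=.
rewrite derive2_support_sphere ?frame_tangent //.
by rewrite frame_orthonormal eqxx mulr1.
Qed.

Lemma grad_sqr_support_scale r y : 0 < r -> y != 0 -> grad_sqr H (r *: y) = grad_sqr H y.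
Proof.
move=> r0 y0; apply: eq_bigr => j _.
by rewrite (homog_derive_support (e_ j) r0 y0) expr0z mul1r.
Qed.

Lemma lap_support_scale r y : 0 < r -> y != 0 ->
  ambient_lap H (r *: y) = r^-1 * ambient_lap H y.
Proof.
move=> r0 y0; rewrite /ambient_lap mulr_sumr; apply: eq_bigr => j _.
by rewrite (homog_derive2_support (e_ j) (e_ j) r0 y0) exprN1.
Qed.

Lemma polar (y : E) : y != 0 -> y = enorm y *: ((enorm y)^-1 *: y).
Proof. by move=> y0; rewrite scalerA mulfV ?scale1r // gt_eqF // enorm_gt0. Qed.

Hypothesis phi_pos : positive_on_sphere phi.

Lemma support_gt0 (y : E) : y != 0 -> 0 < H y.
Proof.
by move=> y0; rewrite mulr_gt0 ?enorm_gt0 //; exact/phi_pos/sphere_normalize.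
Qed.

(** The equation on the sphere says tr U = f / phi. Multiplied by H, all its terms become
    homogeneous of degree 0, so it extends to an open set of the ambient space, where it can be
    differentiated along straight lines. *)
Lemma support_equation (f : E -> R) :
  (forall x, sphere R n x ->
      laplacian phi x - n%:R / 2 * (enorm (grad phi x) ^+ 2 / phi x)
        + n%:R / 2 * (phi x - (phi x)^-1)
      = (phi x)^-1 * f x) ->
  forall y : E, y != 0 ->
    H y * ambient_lap H y = n%:R / 2 * (grad_sqr H y + 1) + rext f y.
Proof.
move=> eqn y y0; have x1 := sphere_normalize y0; have x0 := sphere_neq0 x1.
have N0 : 0 < enorm y by rewrite enorm_gt0.
rewrite /(rext f) (polar y0) -(polar y0); move: x1 x0.
rewrite [in ambient_lap _ _](polar y0) [in grad_sqr _ _](polar y0) support_polar //.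
set x := (_ *: y) => x1 x0.
rewrite lap_support_scale // grad_sqr_support_scale //.
rewrite lap_support_sphere // grad_sqr_support_sphere //.
have p0 : phi x != 0 by rewrite gt_eqF // phi_pos.
have Ny : enorm y != 0 by rewrite gt_eqF.
have -> : f x = phi x * ((phi x)^-1 * f x) by rewrite mulrA mulfV // mul1r.
by rewrite -eqn //; field; rewrite p0.
Qed.

Hypothesis phi_hconvex : h_convex phi.

Lemma Umx_quadratic x c : sphere R n x ->
  2 * phi x * dot (c *m Umx phi x) c =
  2 * phi x * 'D_(tang x c) ('D_(tang x c) H) x - (grad_sqr H x + 1) * dot c c.
Proof.
move=> x1; have p0 : phi x != 0 by rewrite gt_eqF // phi_pos.
rewrite derive2_support_sphere ?dot_tang_base // dot_tang.
rewrite grad_sqr_support_sphere // -(hess_quadratic phi_smooth c x1).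
rewrite /Umx !mulmxDr mulmxN !dotDl dotNl !mul_mx_scalar !dotZl.
by field.
Qed.

(** D^2 H annihilates the radial direction, so only the part of v orthogonal to y counts. The factor
    |y|^2 clears denominators, which lets y and v range freely over the ambient space. *)
Lemma support_hconvex (y v : E) : y != 0 ->
  (grad_sqr H y + 1) * (dot y y * dot v v - dot v y ^+ 2)
    <= 2 * H y * dot y y * 'D_v ('D_v H) y.
Proof.
move=> y0; have x1 := sphere_normalize y0; have x0 := sphere_neq0 x1.
have N0 : 0 < enorm y by rewrite enorm_gt0.
rewrite (polar y0); move: x1 x0; set x := (_^-1 *: y); move: (enorm y) N0 => r r0 x1 x0.
rewrite grad_sqr_support_scale // (homog_support r0 x0) expr1z support_sphere //.
rewrite (homog_derive2_support v v r0 x0) exprN1.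
clearbody x; rewrite !dotZl !dotZr (_ : dot x x = 1) // mulr1.
have vE := tang_decomp v x1; set a := dot v x in vE *; set c := (\row_b _) in vE.
have -> : 'D_v ('D_v H) x = 'D_(tang x c) ('D_(tang x c) H) x.
  rewrite vE (derive2_linearl _ _ _ _ sH x0) derive2_support_radial // mulr0 add0r.
  by rewrite (derive2_linearr _ _ _ _ open_punctured sH x0) derive2_support_radialr // mulr0 add0r.
have -> : dot v v = a ^+ 2 + dot c c.
  rewrite vE !dotDl !dotDr !dotZl !dotZr dot_tang [dot x (tang _ _)]dotC.
  by rewrite dot_tang_base // (_ : dot x x = 1) //; ring.
have := phi_hconvex x1 c; have := phi_pos x1; have := Umx_quadratic c x1.
set q := dot (_ *m _) _ => qE p0 q0.
have rn : r != 0 by rewrite gt_eqF.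
have -> : 2 * (r * phi x) * (r * r) * (r^-1 * 'D_(tang x c) ('D_(tang x c) H) x) =
  r * r * (2 * phi x * q + (grad_sqr H x + 1) * dot c c) by rewrite qE; field.
have : 0 <= r * r * (2 * phi x * q) by rewrite !mulr_ge0 // ltW.
move: (phi x) (grad_sqr H x) (dot c c) => p g cc; lra.
Qed.

End Support.

(** * Comparison along great circles *)

Section Riccati.
Context {R : realType}.

Lemma le_of_derive_ge0 (g dg : R -> R) (a b : R) : a <= b ->
  (forall t : R, is_derive t 1 g (dg t)) ->
  (forall t, a <= t <= b -> 0 <= dg t) -> g a <= g b.
Proof.
move=> ab gd dg0.
have [|t tab gE] := @MVT_segment _ g dg a b ab (fun t _ => gd t).
  by apply: derivable_within_continuous => t _; exact: ex_derive.
rewrite -subr_ge0 gE mulr_ge0 ?subr_ge0 //; apply: dg0.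
by move: tab; rewrite in_itv.
Qed.

Variables (u du ddu : R -> R).
Hypothesis u_gt0 : forall t, 0 < u t.
Hypothesis u_der : forall t : R, is_derive t 1 u (du t).
Hypothesis du_der : forall t : R, is_derive t 1 du (ddu t).
Hypothesis u_ineq : forall t, du t ^+ 2 + 1 <= 2 * u t * ddu t + u t ^+ 2.
Variable theta : R.
Hypothesis theta_pi : 0 <= theta <= pi.

Local Notation z t := (sin ((theta - t) / 2)).
Local Notation c t := (cos ((theta - t) / 2)).

Let half_der (t : R) : is_derive t 1 (fun s => (theta - s) / 2) (- 2^-1).
Proof.
have := is_deriveM (is_deriveB (is_derive_cst theta t 1) (is_derive_id t 1))
  (is_derive_cst (2^-1 : R) t 1).
by rewrite sub0r scaler0 add0r /GRing.scale /= mulrN1.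
Qed.

Let z_der (t : R) : is_derive t 1 (fun s => z s) (- (c t / 2)).
Proof.
apply: is_derive_eq (is_derive1_comp (is_derive_sin _) (half_der t)) _.
by rewrite mulrN.
Qed.

Let c_der (t : R) : is_derive t 1 (fun s => c s) (z t / 2).
Proof.
apply: is_derive_eq (is_derive1_comp (is_derive_cos _) (half_der t)) _.
by rewrite mulrNN.
Qed.

Let z_ge0 t : 0 <= t <= theta -> 0 <= z t.
Proof.
move=> /andP[t0 tt]; apply: sin_ge0_pi; move: theta_pi (@pi_gt0 R) => /andP[? ?] ?.
by apply/andP; split; lra.
Qed.

(* With [psi = sqrt u], [wronskian / (2 psi)] is the Wronskian of [psi] and of
   the solution [z] of [z'' + z / 4 = 0]. *)
Let wronskian t := du t * z t + u t * c t.

Let wronskian_der (t : R) :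
  is_derive t 1 wronskian (ddu t * z t + du t * c t / 2 + u t * z t / 2).
Proof.
have := is_deriveD (is_deriveM (du_der t) (z_der t)) (is_deriveM (u_der t) (c_der t)).
by move=> h; apply: is_derive_eq h _; rewrite /GRing.scale /=; field.
Qed.

Let defect_ge0 t : 0 <= 2 * u t * ddu t + u t ^+ 2 - du t ^+ 2.
Proof. by have := u_ineq t; lra. Qed.

(** For psi = sqrt u the hypothesis gives psi'' + psi/4 >= 0, and z is nonnegative up to theta; the
    derivative of the Wronskian of psi and z is z (psi'' + psi/4). *)
Lemma wronskian_mono t : 0 <= t <= theta ->
  wronskian 0 / Num.sqrt (u 0) <= wronskian t / Num.sqrt (u t).
Proof.
move=> /andP[t0 tt]; pose s t := Num.sqrt (u t).
have s0 r : 0 < s r by rewrite sqrtr_gt0.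
have s_der (r : R) : is_derive r 1 s ((2 * s r)^-1 * du r).
  exact: is_derive1_comp (is_derive1_sqrt (u_gt0 r)) (u_der r).
have sI_der (r : R) : is_derive r 1 (fun r => (s r)^-1) (- (s r) ^- 2 * ((2 * s r)^-1 * du r)).
  by apply: is_deriveV (s_der r); rewrite gt_eqF.
pose dG r := z r * (2 * u r * ddu r + u r ^+ 2 - du r ^+ 2) / (2 * u r * s r).
apply: (@le_of_derive_ge0 (fun r => wronskian r / s r) dG) => // [r|r /andP[r0 rt]].
  apply: is_derive_eq (is_deriveM (wronskian_der r) (sI_der r)) _.
  have uE : u r = s r ^+ 2 by rewrite sqr_sqrtr // ltW.
  rewrite /dG /wronskian /GRing.scale /= uE; field.
  by rewrite gt_eqF.
apply: divr_ge0; first by apply: mulr_ge0 => //; apply: z_ge0; rewrite r0 (le_trans rt).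
by rewrite ltW // mulr_gt0 // mulr_gt0.
Qed.

Lemma wronskian_ge0 t : 0 <= wronskian 0 -> 0 <= t <= theta -> 0 <= wronskian t.
Proof.
move=> w0 /wronskian_mono; have s0 r : 0 < Num.sqrt (u r) by rewrite sqrtr_gt0.
rewrite ler_pdivlMr // => h; apply: le_trans h.
by rewrite mulr_ge0 ?divr_ge0 // ltW.
Qed.

(* Geometrically, [(z t ^+ 2 + wronskian t ^+ 2) / u t] is the value at [theta] of
   the solution of [2 u u'' = u'^2 + 1 - u^2] osculating [u] to first order at [t]. *)
Lemma horo_energy_mono : 0 <= wronskian 0 ->
  (z 0 ^+ 2 + wronskian 0 ^+ 2) / u 0 <= u theta.
Proof.
move=> w0; have uI_der (r : R) : is_derive r 1 (fun r => (u r)^-1) (- (u r) ^- 2 * du r).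
  by apply: is_deriveV (u_der r); rewrite gt_eqF.
pose J r := (z r ^+ 2 + wronskian r ^+ 2) / u r.
have -> : u theta = J theta.
  rewrite /J /wronskian subrr mul0r sin0 cos0 expr0n mulr0 !add0r mulr1.
  by field; rewrite gt_eqF.
pose dJ r := z r * wronskian r * (2 * u r * ddu r + u r ^+ 2 - du r ^+ 2 - 1) / (u r) ^+ 2.
apply: (@le_of_derive_ge0 J dJ) => [|r|r /andP[r0 rt]]; first by case/andP: theta_pi.
  have z2_der := is_deriveM (z_der r) (z_der r).
  have w2_der := is_deriveM (wronskian_der r) (wronskian_der r).
  have := is_deriveM (is_deriveD z2_der w2_der) (uI_der r).
  rewrite (_ : (_ + _) * _ = J); last by apply/funext => q; rewrite /J !expr2.
  move=> h; apply: is_derive_eq h _; rewrite /dJ !fctE /wronskian /GRing.scale /=; field.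
  by rewrite gt_eqF.
have rI : 0 <= r <= theta by rewrite r0.
apply: divr_ge0; last exact: sqr_ge0.
apply: mulr_ge0; last by have := u_ineq r; lra.
by apply: mulr_ge0; [exact: z_ge0 | exact: wronskian_ge0].
Qed.

End Riccati.

Section RiccatiConsequences.
Context {R : realType}.
Variables (u du ddu : R -> R).
Hypothesis u_gt0 : forall t, 0 < u t.
Hypothesis u_der : forall t : R, is_derive t 1 u (du t).
Hypothesis du_der : forall t : R, is_derive t 1 du (ddu t).
Hypothesis u_ineq : forall t, du t ^+ 2 + 1 <= 2 * u t * ddu t + u t ^+ 2.

(** Take theta = pi: z goes from 1 to 0 and its companion cosine from 0 to 1, so [wronskian] goes
    from u'(0) to u(pi), while the weight sqrt u has equal values at both ends. *)
Lemma slope_le : u pi = u 0 -> du 0 <= u 0.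
Proof.
move=> uE; have pi0 : 0 <= (pi : R) <= pi by rewrite pi_ge0 lexx.
have := wronskian_mono u_gt0 u_der du_der u_ineq pi0 pi0.
rewrite uE subrr subr0 mul0r sin0 cos0 sin_pihalf cos_pihalf !mulr0 !mulr1 add0r addr0.
by rewrite ler_pM2r // invr_gt0 sqrtr_gt0.
Qed.

(** The left-hand side, as a function of theta, solves 2 u u'' = u'^2 + 1 - u^2 with the same value
    as u and zero slope at 0. *)
Lemma horo_comparison theta : 0 <= theta <= pi -> du 0 = 0 ->
  u 0 * cos (theta / 2) ^+ 2 + sin (theta / 2) ^+ 2 / u 0 <= u theta.
Proof.
move=> th d0; have := horo_energy_mono u_gt0 u_der du_der u_ineq th.
rewrite d0 mul0r add0r subr0 => h; apply: le_trans (h _).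
  by rewrite le_eqVlt; apply/orP; left; apply/eqP; field; rewrite gt_eqF.
apply: mulr_ge0; [exact: ltW | apply: cos_ge0_pihalf]; move: th (@pi_gt0 R) => /andP[? ?] ?.
by apply/andP; split; lra.
Qed.

End RiccatiConsequences.

(** * The comparison inequality along great circles *)

Section Geodesics.
Context {R : realType} {n : nat}.
Local Notation E := 'rV[R]_n.+1.
Local Notation punctured := [set y : E | y != 0].

Lemma bessel_two (v w g : E) : dot v v = 1 -> dot w w = 1 -> dot v w = 0 ->
  dot v g ^+ 2 + dot w g ^+ 2 <= dot g g.
Proof.
move=> vv ww vw; have := dot_ge0 (g - dot v g *: v - dot w g *: w).
rewrite !(dotDl, dotDr, dotNl, dotNr, dotZl, dotZr) vv ww (dotC w v) vw.
by rewrite (dotC g v) (dotC g w); move: (dot g g) (dot v g) (dot w g) => a b c; nra.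
Qed.

Definition geodesic (x e : E) (t : R) : E := cos t *: x + sin t *: e.

Lemma geodesic0 x e : geodesic x e 0 = x.
Proof. by rewrite /geodesic cos0 sin0 scale1r scale0r addr0. Qed.

Lemma geodesicpi x e : geodesic x e pi = - x.
Proof. by rewrite /geodesic cospi sinpi scaleN1r scale0r addr0. Qed.

Lemma is_derive_geodesic (x e : E) (t : R) :
  is_derive t 1 (geodesic x e) (- sin t *: x + cos t *: e).
Proof.
have dZ (g : R -> R) (a : E) dg : is_derive t 1 g dg ->
    is_derive t 1 (fun s => g s *: a) (dg *: a).
  move=> gd; have dg1 : differentiable g t by apply/derivable1_diffP.
  have dga := differentiableZl a dg1.
  apply: DeriveDef; first exact: diff_derivable.
  by rewrite deriveE // diffZl //= -deriveE // (@derive_val _ _ _ _ _ _ _ gd).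
exact: is_deriveD (dZ _ x _ (is_derive_cos t)) (dZ _ e _ (is_derive_sin t)).
Qed.

Lemma is_derive_along (A : set E) (G : E -> R) (g : R -> E) (t : R) (v : E) :
  smooth_on A G -> A (g t) -> is_derive t 1 g v ->
  is_derive t 1 (fun s => G (g s)) ('D_v G (g t)).
Proof.
move=> sG Ag gv; have dg : differentiable g t by apply/derivable1_diffP.
have dG := smooth_differentiable sG Ag.
have dGg := differentiable_comp dg dG.
apply: DeriveDef; first exact: diff_derivable.
rewrite deriveE // (diff_comp dg dG) /= -(deriveE _ dg) (@derive_val _ _ _ _ _ _ _ gv).
by rewrite deriveE.
Qed.

Section UnitSpeed.
Variables (x e : E).
Hypotheses (x1 : sphere R n x) (e1 : dot e e = 1) (ex : dot e x = 0).

Let v t : E := - sin t *: x + cos t *: e.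

Lemma dot_geodesic t : dot (geodesic x e t) (geodesic x e t) = 1.
Proof.
rewrite !dotDl !dotDr !dotZl !dotZr (dotC x e) ex e1 (_ : dot x x = 1) //.
by rewrite -[RHS](cos2Dsin2 t); ring.
Qed.

Lemma sphere_geodesic t : sphere R n (geodesic x e t).
Proof. exact: dot_geodesic. Qed.

Let dot_v t : dot (v t) (v t) = 1.
Proof.
rewrite !dotDl !dotDr !dotZl !dotZr (dotC x e) ex e1 (_ : dot x x = 1) //.
by rewrite -[RHS](cos2Dsin2 t); ring.
Qed.

Let dot_v_geodesic t : dot (v t) (geodesic x e t) = 0.
Proof.
rewrite !dotDl !dotDr !dotZl !dotZr (dotC x e) ex e1 (_ : dot x x = 1) //.
by ring.
Qed.

Variable phi : E -> R.
Hypotheses (phi_smooth : smooth_on_sphere phi) (phi_pos : positive_on_sphere phi).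
Hypothesis phi_hconvex : h_convex phi.
Local Notation H := (hsupport phi).

Let u (t : R) : R := H (geodesic x e t).
(** Expanded over the fixed directions x and e, because the direction [v t] itself moves with t when
    this is differentiated again. *)
Let du (t : R) : R := - sin t * 'D_x H (geodesic x e t) + cos t * 'D_e H (geodesic x e t).
(** The acceleration of a great circle is minus its position, and by Euler's relation the derivative
    of H along the position is H; hence the term -u. *)
Let ddu (t : R) : R := 'D_(v t) ('D_(v t) H) (geodesic x e t) - u t.

Let sH := smooth_support phi_smooth.

Let g0 t : geodesic x e t != 0.
Proof. exact/sphere_neq0/sphere_geodesic. Qed.

Let derive_v t (G : E -> R) : smooth_on punctured G ->
  'D_(v t) G (geodesic x e t) =
    - sin t * 'D_x G (geodesic x e t) + cos t * 'D_e G (geodesic x e t).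
Proof.
move=> sG; rewrite (derive_linear (- sin t) x (cos t *: e) sG (g0 t)).
congr (_ + _); rewrite -[cos t *: e]addr0 (derive_linear (cos t) e 0 sG (g0 t)).
by rewrite derive0 addr0.
Qed.

Let duE t : du t = 'D_(v t) H (geodesic x e t).
Proof. by rewrite derive_v. Qed.

Let u_der (t : R) : is_derive t 1 u (du t).
Proof. by rewrite duE; apply: is_derive_along sH (g0 t) (is_derive_geodesic x e t). Qed.

Let du_der (t : R) : is_derive t 1 du (ddu t).
Proof.
have dD w := is_derive_along (smooth_derive w sH) (g0 t) (is_derive_geodesic x e t).
have := is_deriveD (is_deriveM (is_deriveN (is_derive_sin t)) (dD x))
  (is_deriveM (is_derive_cos t) (dD e)).
move=> h; apply: is_derive_eq h _; rewrite /ddu -/(v t).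
have -> : 'D_(v t) ('D_(v t) H) (geodesic x e t) =
    - sin t * 'D_(v t) ('D_x H) (geodesic x e t) +
    cos t * 'D_(v t) ('D_e H) (geodesic x e t).
  rewrite {2}/v (derive2_linearr (- sin t) (v t) x (cos t *: e) open_punctured sH (g0 t)).
  congr (_ + _); rewrite -[cos t *: e]addr0.
  rewrite (derive2_linearr (cos t) (v t) e 0 open_punctured sH (g0 t)).
  rewrite (_ : 'D_0 H = cst 0) ?derive_cst ?addr0 //.
  by apply/funext => y; rewrite derive0.
have -> : u t = cos t * 'D_x H (geodesic x e t) + sin t * 'D_e H (geodesic x e t).
  have := homog_euler sH (homog_support phi) (g0 t).
  rewrite mul1r -/(u t) => <-.
  rewrite {1}/geodesic (derive_linear (cos t) x (sin t *: e) sH (g0 t)).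
  congr (_ + _); rewrite -[sin t *: e]addr0 (derive_linear (sin t) e 0 sH (g0 t)).
  by rewrite derive0 addr0.
rewrite /GRing.scale /= !fctE.
by move: ('D_x H _) ('D_e H _) ('D_(v t) _ _) ('D_(v t) _ _) => a b c d; ring.
Qed.

Let u_gt0 t : 0 < u t.
Proof. by apply: support_gt0; [exact: phi_pos | exact: g0]. Qed.

Let grad_ge t : du t ^+ 2 + u t ^+ 2 <= grad_sqr H (geodesic x e t).
Proof.
set y := geodesic x e t; pose g : E := \row_j 'D_(delta_mx 0 j) H y.
have -> : grad_sqr H y = dot g g by apply: eq_bigr => j _; rewrite mxE expr2.
have -> : du t = dot (v t) g by rewrite duE; exact: derive_dot sH (g0 t).
have -> : u t = dot y g.
  have := homog_euler sH (homog_support phi) (g0 t); rewrite mul1r -/(u t) => <-.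
  exact: derive_dot sH (g0 t).
exact: bessel_two (dot_v t) (dot_geodesic t) (dot_v_geodesic t).
Qed.

(** This is h-convexity in the direction of motion, where D^2 H equals u'' + u; the velocity and the
    position are orthonormal, so |DH|^2 >= u'^2 + u^2. *)
Let u_ineq t : du t ^+ 2 + 1 <= 2 * u t * ddu t + u t ^+ 2.
Proof.
have := support_hconvex phi_smooth phi_pos phi_hconvex (v t) (g0 t).
rewrite dot_v dot_geodesic dot_v_geodesic expr0n subr0 !mulr1 -/(u t) /ddu.
have := grad_ge t.
move: (du t) (u t) (grad_sqr _ _) ('D_(v t) _ _) => a b c d; nra.
Qed.

Let uE t : u t = phi (geodesic x e t).
Proof. exact: support_sphere (sphere_geodesic t). Qed.

Lemma derive_rext_le : phi (- x) = phi x -> 'D_e (rext phi) x <= phi x.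
Proof.
move=> pe; have := slope_le u_gt0 u_der du_der u_ineq.
rewrite !uE geodesic0 geodesicpi => /(_ pe).
rewrite /du geodesic0 sin0 cos0 oppr0 mul0r add0r mul1r.
by rewrite derive_support_sphere // dotC ex mulr0 addr0.
Qed.

Lemma support_comparison theta : 0 <= theta <= pi ->
  'D_e (rext phi) x = 0 ->
  phi x * cos (theta / 2) ^+ 2 + sin (theta / 2) ^+ 2 / phi x
    <= phi (geodesic x e theta).
Proof.
move=> th d0; have := horo_comparison u_gt0 u_der du_der u_ineq th.
rewrite !uE geodesic0; apply.
rewrite /du geodesic0 sin0 cos0 oppr0 mul0r add0r mul1r.
by rewrite derive_support_sphere // dotC ex mulr0 addr0.
Qed.

End UnitSpeed.
End Geodesics.

(** * Extrema on the sphere and great circles through two points *)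

Section SphereExtrema.
Context {R : realType} {n : nat}.
Local Notation E := 'rV[R]_n.+1.
Local Notation punctured := [set y : E | y != 0].
Implicit Types (f : E -> R) (v w x y : E).

Lemma sphere_nonempty : sphere R n !=set0.
Proof.
exists (delta_mx 0 0); rewrite /sphere /= /dot (bigD1 ord0) //= !mxE !eqxx mulr1.
by rewrite big1 ?addr0 // => i i0; rewrite !mxE (negbTE i0) andbF mulr0.
Qed.

Lemma compact_sphere : compact (sphere R n).
Proof.
apply: bounded_closed_compact.
  exists 1; split => // M M1 x x1; apply: le_trans (ltW M1).
  rewrite [leLHS]/Num.Def.normr /= mx_normrE; apply: bigmax_le => //= -[i j] _ /=.
  rewrite ord1 -(@expr_le1 _ 2) // real_normK ?num_real // -(_ : dot x x = 1) //.
  rewrite /dot (bigD1 j) //= -expr2 lerDl sumr_ge0 // => k _.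
  by rewrite -expr2 sqr_ge0.
rewrite (_ : sphere R n = (fun y => dot y y) @^-1` [set 1]) //.
apply: closed_comp; last exact: closed_eq.
move=> y _; apply: differentiable_continuous.
exact: (smooth_differentiable (smooth_dot_self openT)).
Qed.

Lemma continuous_rext f : smooth_on_sphere f ->
  {within sphere R n, continuous (rext f)}.
Proof.
move=> sf; apply: continuous_in_subspaceT => x; rewrite inE => x1.
apply: differentiable_continuous.
exact: smooth_differentiable sf (sphere_neq0 x1).
Qed.

Lemma sphere_max f : smooth_on_sphere f ->
  exists2 x, sphere R n x & forall y, sphere R n y -> f y <= f x.
Proof.
move=> sf; have [x] := EVT_max_rV sphere_nonempty compact_sphere (continuous_rext sf).
rewrite inE => x1 xmax; exists x => // y y1; rewrite -(rext_sphere f x1).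
by rewrite -(rext_sphere f y1) xmax // inE.
Qed.

Lemma sphere_min f : smooth_on_sphere f ->
  exists2 x, sphere R n x & forall y, sphere R n y -> f x <= f y.
Proof.
move=> sf; have [x] := EVT_min_rV sphere_nonempty compact_sphere (continuous_rext sf).
rewrite inE => x1 xmin; exists x => // y y1; rewrite -(rext_sphere f x1).
by rewrite -(rext_sphere f y1) xmin // inE.
Qed.

Lemma near_line_punctured x v : x != 0 -> \forall t \near (0 : R), x + t *: v != 0.
Proof. by move=> x0; exact: (nbhs_line v open_punctured x0). Qed.

Lemma derive_at_sphere_min f x v : smooth_on_sphere f -> sphere R n x ->
  (forall y, sphere R n y -> f x <= f y) ->
  'D_v (rext f) x = 0 /\ 0 <= 'D_v ('D_v (rext f)) x.
Proof.
move=> sf x1 xmin; have x0 := sphere_neq0 x1.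
apply: (jet2_min (jet2_line v open_punctured sf x0)).
apply: filterS (near_line_punctured v x0) => t y0.
by rewrite rext_sphere //; apply: xmin; exact: sphere_normalize.
Qed.

Lemma derive_at_sphere_max f x v : smooth_on_sphere f -> sphere R n x ->
  (forall y, sphere R n y -> f y <= f x) -> 'D_v (rext f) x = 0.
Proof.
move=> sf x1 xmax; have x0 := sphere_neq0 x1.
have [] := jet2_min (jet2M (jet2_cst (- 1)) (jet2_line v open_punctured sf x0)).
  apply: filterS (near_line_punctured v x0) => t y0.
  rewrite !mulN1r lerN2 (rext_sphere f x1); apply: xmax; exact: sphere_normalize.
by rewrite mul0r add0r mulN1r => /eqP; rewrite oppr_eq0 => /eqP.
Qed.

Lemma sup_sphere_ge f x : smooth_on_sphere f -> sphere R n x ->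
  f x <= sup (f @` sphere R n).
Proof.
move=> sf x1; apply: ub_le_sup; last by exists x.
have [y _ ymax] := sphere_max sf; exists (f y) => _ [z z1 <-]; exact: ymax.
Qed.

Lemma geodesic_exists x y : (0 < n)%N -> sphere R n x -> sphere R n y ->
  exists e theta, [/\ dot e e = 1, dot e x = 0, 0 <= theta <= pi &
    y = geodesic x e theta].
Proof.
move=> n0 x1 y1; set a := dot y x; set w := y - a *: x.
have xx : dot x x = 1 by []. have yy : dot y y = 1 by [].
have ww : dot w w = 1 - a ^+ 2.
  rewrite !dotDl !dotDr !(dotNl, dotNr, dotZl, dotZr) xx yy (dotC x y) -/a; ring.
have wx : dot w x = 0 by rewrite dotDl dotNl dotZl xx mulr1 subrr.
have a1 : -1 <= a <= 1.
  by have := dot_ge0 w; rewrite ww => h; apply/andP; split; nra.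
have aI : a \in `[-1, 1] by rewrite in_itv.
have yE : y = a *: x + w by rewrite addrC subrK.
have tI : 0 <= acos a <= pi by rewrite acos_ge0 // acos_lepi.
have [w0|w0] := eqVneq w 0.
  (* Here y is x or -x and every tangent direction serves; [n0] guarantees that there is one. *)
  exists (frame x (Ordinal n0)), (acos a); split=> //.
  - by rewrite frame_orthonormal eqxx.
  - exact: frame_tangent.
  - by rewrite {1}yE w0 /geodesic acosK // sin_acos // -ww w0 dot0l sqrtr0 scale0r.
have N0 : enorm w != 0 by rewrite gt_eqF // enorm_gt0.
exists ((enorm w)^-1 *: w), (acos a); split=> //.
- by rewrite dotZl dotZr -enorm_sqr; field.
- by rewrite dotZl wx mulr0.
- rewrite {1}yE /geodesic acosK // sin_acos // -ww -/(enorm w) scalerA.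
  by rewrite mulfV // scale1r.
Qed.

End SphereExtrema.

(** * The bounds on |Dphi| and on phi^2 *)

Section SupportBounds.
Context {R : realType} {n : nat}.
Local Notation E := 'rV[R]_n.+1.
Variable phi : E -> R.
Hypotheses (phi_smooth : smooth_on_sphere phi) (phi_pos : positive_on_sphere phi).
Hypotheses (phi_even : even_on_sphere phi) (phi_hconvex : h_convex phi).

Lemma slope_bound (x w : E) : sphere R n x -> dot w x = 0 ->
  'D_w (rext phi) x <= enorm w * phi x.
Proof.
move=> x1 wx; have [->|w0] := eqVneq w 0.
  by rewrite derive0 mulr_ge0 ?enorm_ge0 // ltW // phi_pos.
have N0 : 0 < enorm w by rewrite enorm_gt0.
have Nn : enorm w != 0 by rewrite gt_eqF.
pose e := (enorm w)^-1 *: w.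
have ee : dot e e = 1 by rewrite dotZl dotZr -enorm_sqr; field.
have ex : dot e x = 0 by rewrite dotZl wx mulr0.
have := derive_rext_le x1 ee ex phi_smooth phi_pos phi_hconvex (phi_even x1).
have -> : 'D_e (rext phi) x = (enorm w)^-1 * 'D_w (rext phi) x.
  rewrite /e -[X in 'D_X _ _]addr0 (derive_linear _ w 0 phi_smooth (sphere_neq0 x1)).
  by rewrite derive0 addr0.
by rewrite mulrC ler_pdivrMr // mulrC.
Qed.

Hypothesis n_gt0 : (0 < n)%N.

(** The comparisons from x at angle th and from -x at angle pi - th carry the weights cos^2(th/2)
    and sin^2(th/2) in exchanged roles. These add up to 1, so the sum of the two bounds is
    independent of y. *)
Lemma support_ge_mean (x y : E) : sphere R n x -> sphere R n y ->
  (forall z, sphere R n z -> phi z <= phi x) ->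
  phi x + (phi x)^-1 <= 2 * phi y.
Proof.
move=> x1 y1 xmax; have [e [th [ee ex thI yE]]] := geodesic_exists n_gt0 x1 y1.
have h1 := support_comparison x1 ee ex phi_smooth phi_pos phi_hconvex thI
  (derive_at_sphere_max e phi_smooth x1 xmax).
have x1' : sphere R n (- x) by rewrite /sphere /= dotNl dotNr opprK.
have ex' : dot e (- x) = 0 by rewrite dotNr ex oppr0.
have xmax' z : sphere R n z -> phi z <= phi (- x) by rewrite phi_even //; exact: xmax.
have thI' : 0 <= pi - th <= pi.
  by move: thI => /andP[? ?]; apply/andP; split; lra.
have := support_comparison x1' ee ex' phi_smooth phi_pos phi_hconvex thI'
  (derive_at_sphere_max e phi_smooth x1' xmax').
rewrite (_ : geodesic (- x) e (pi - th) = y); last first.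
  rewrite yE /geodesic cosB sinB cospi sinpi !mul0r add0r addr0.
  by rewrite scalerN !mulN1r scaleNr !opprK.
rewrite phi_even // mulrBl cosB sinB sin_pihalf cos_pihalf !mul0r !mul1r add0r subr0.
rewrite -yE in h1; move: h1; have := cos2Dsin2 (th / 2).
move: (cos _ ^+ 2) (sin _ ^+ 2) (phi x) (phi y) => a b p q.
move: p^-1 => r; nra.
Qed.

Variable f : E -> R.
Hypothesis f_smooth : smooth_on_sphere f.
Hypothesis phi_eq : forall x, sphere R n x ->
      laplacian phi x - n%:R / 2 * (enorm (grad phi x) ^+ 2 / phi x)
        + n%:R / 2 * (phi x - (phi x)^-1)
      = (phi x)^-1 * f x.

Lemma support_min_bound (x : E) : sphere R n x ->
  (forall z, sphere R n z -> phi x <= phi z) ->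
  phi x ^+ 2 <= 1 + 2 / n%:R * f x.
Proof.
move=> x1 xmin; have p0 := phi_pos x1.
have pn0 : phi x != 0 by rewrite gt_eqF.
have nR0 : 0 < n%:R :> R by rewrite ltr0n.
have crit v := derive_at_sphere_min v phi_smooth x1 xmin.
have lap0 : 0 <= laplacian phi x.
  by rewrite laplacianE //; apply: sumr_ge0 => a _; have [] := crit (frame x a).
have := phi_eq x1; rewrite enorm_grad_frame // big1; last first.
  by move=> a _; have [-> _] := crit (frame x a); rewrite expr0n.
rewrite mul0r mulr0 subr0 => eqn.
have -> : f x = phi x * ((phi x)^-1 * f x) by rewrite mulrA mulfV // mul1r.
rewrite -eqn -subr_ge0.
have -> : 1 + 2 / n%:R * (phi x * (laplacian phi x + n%:R / 2 * (phi x - (phi x)^-1)))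
    - phi x ^+ 2 = 2 / n%:R * (phi x * laplacian phi x).
  by field; rewrite pn0 gt_eqF.
by rewrite !mulr_ge0 // ?invr_ge0 ltW.
Qed.

Lemma support_sqr_bound (x : E) : sphere R n x ->
  phi x ^+ 2 < 8 / n%:R * sup (f @` sphere R n) + 2.
Proof.
move=> x1; have [xM M1 maxM] := sphere_max phi_smooth.
have [xm m1 minm] := sphere_min phi_smooth.
have nR0 : 0 < n%:R :> R by rewrite ltr0n.
have h1 := support_ge_mean M1 m1 maxM; have h2 := support_min_bound m1 minm.
have h3 : 2 / n%:R * f xm <= 2 / n%:R * sup (f @` sphere R n).
  by rewrite ler_pM2l ?divr_gt0 //; exact: sup_sphere_ge.
have M0 := phi_pos M1; have Mi0 : 0 < (phi xM)^-1 by rewrite invr_gt0.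
have MM : phi xM * (phi xM)^-1 = 1 by rewrite mulfV // gt_eqF.
have xM2 : phi x ^+ 2 <= phi xM ^+ 2.
  by rewrite ler_sqr ?nnegrE ?maxM // ltW // phi_pos.
apply: le_lt_trans xM2 _; have -> : 8 / n%:R = 4 * (2 / n%:R) :> R by field; rewrite gt_eqF.
have m0 := phi_pos m1; rewrite -mulrA.
move: h1 h2 h3 M0 Mi0 MM m0; move: (phi xM)^-1 => r.
move: (_ / n%:R * sup _) (phi xM) (phi xm) (_ / n%:R * _) => S M m F h1 h2 h3 M0 Mi0 MM m0.
(* With r = 1/M this reads M^2 + 2 + r^2 <= 4 m^2 <= 4 + (8/n) sup f. Dropping r^2 > 0 makes the
   bound strict and leaves the constant 2. *)
have : (M + r) ^+ 2 <= (2 * m) ^+ 2 by rewrite ler_sqr ?nnegrE //; lra.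
nra.
Qed.

End SupportBounds.

(** * The second-order condition at a null vector *)

Section HigherSymmetry.
Context {R : realType} {n : nat}.
Local Notation E := 'rV[R]_n.+1.
Variables (A : set E) (F : E -> R).
Hypotheses (oA : open A) (sF : smooth_on A F).
Implicit Types (u v w x : E).

Lemma derive3_comm12 u v w x : A x ->
  'D_u ('D_v ('D_w F)) x = 'D_v ('D_u ('D_w F)) x.
Proof. by move=> Ax; exact: derive_comm oA (smooth_derive w sF) Ax. Qed.

Lemma derive3_comm23 u v w x : A x ->
  'D_u ('D_v ('D_w F)) x = 'D_u ('D_w ('D_v F)) x.
Proof.
move=> Ax; apply: (derive_eq_on u oA Ax) => y Ay; exact: derive_comm oA sF Ay.
Qed.

Lemma derive4_comm u v x : A x ->
  'D_u ('D_u ('D_v ('D_v F))) x = 'D_v ('D_v ('D_u ('D_u F))) x.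
Proof.
move=> Ax; transitivity ('D_u ('D_v ('D_u ('D_v F))) x).
  by apply: (derive_eq_on u oA Ax) => y Ay; exact: derive3_comm12.
transitivity ('D_v ('D_u ('D_u ('D_v F))) x).
  exact: derive_comm oA (smooth_derive u (smooth_derive v sF)) Ax.
apply: (derive_eq_on v oA Ax) => y Ay.
exact: (etrans (derive3_comm23 u u v Ay) (derive3_comm12 u v u Ay)).
Qed.

Lemma derive2_quadratic t v w x : A x ->
  'D_(t *: v + w) ('D_(t *: v + w) F) x =
    'D_w ('D_w F) x + (2 * (t * 'D_w ('D_v F) x) + t * t * 'D_v ('D_v F) x).
Proof.
move=> Ax; apply: (etrans (derive2_linearl t v w (t *: v + w) sF Ax)).
apply: (etrans (congr2 (fun a b => t * a + b)
  (derive2_linearr t v v w oA sF Ax) (derive2_linearr t w v w oA sF Ax))).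
have alg (a c d d' : R) : d = d' ->
    t * (t * a + d) + (t * d' + c) = c + (2 * (t * d') + t * t * a).
  by move=> ->; ring.
exact: alg (derive_comm v w oA sF Ax).
Qed.

End HigherSymmetry.

Lemma jet2_eqv {R : realType} (g : R -> R) (a b c a' b' c' : R) : jet2 g a b c ->
  a = a' -> b = b' -> c = c' -> jet2 g a' b' c'.
Proof. by move=> J <- <- <-. Qed.

(** The product rule for the function [defect] below, on abstract jets: h, q, r, s, k stand for H,
    the second derivatives of H in (xi, xi), (xi, V), (V, V), and |DH|^2 + 1 along the line. *)
Lemma jet2_test {R : realType} (h q r s k : R -> R)
    (h0 h1 h2 q0 q1 q2 r0 r1 r2 s0 s1 s2 k0 k1 k2 xv vv vu xu : R) :
  jet2 h h0 h1 h2 -> jet2 q q0 q1 q2 -> jet2 r r0 r1 r2 -> jet2 s s0 s1 s2 ->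
  jet2 k k0 k1 k2 ->
  jet2 (fun t => 2 * (h t * (q t + (2 * (t * r t) + t * t * s t)))
      + - 1 * (k t * (1 + t * (2 * xv) + t * t * vv
         + - 1 * ((t * xu + t * t * vu) * (t * xu + t * t * vu)))))
    (2 * h0 * q0 - k0)
    (2 * h1 * q0 + 2 * h0 * (q1 + 2 * r0) - (k1 + 2 * k0 * xv))
    (2 * (h2 * q0 + 2 * h1 * (q1 + 2 * r0) + h0 * (q2 + 4 * r1 + 2 * s0))
      - (k2 + 4 * k1 * xv + 2 * k0 * (vv - xu ^+ 2))).
Proof.
move=> Jh Jq Jr Js Jk.
have Jl a := jet2M (@jet2_id R) (jet2_cst a).
have Jt2 := jet2M (@jet2_id R) (@jet2_id R).
have Jc := jet2D (Jl xu) (jet2M Jt2 (jet2_cst vu)).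
have Jp := jet2D (jet2D (jet2D (jet2_cst 1) (Jl (2 * xv))) (jet2M Jt2 (jet2_cst vv)))
  (jet2M (jet2_cst (- 1)) (jet2M Jc Jc)).
have JQ := jet2D Jq (jet2D (jet2M (jet2_cst 2) (jet2M (@jet2_id R) Jr)) (jet2M Jt2 Js)).
have J := jet2D (jet2M (jet2_cst 2) (jet2M Jh JQ))
  (jet2M (jet2_cst (- 1)) (jet2M Jk Jp)).
by apply: (jet2_eqv J); ring.
Qed.

Section SecondOrderTest.
Context {R : realType} {n : nat}.
Local Notation E := 'rV[R]_n.+1.
Local Notation punctured := [set y : E | y != 0].
Variable phi : E -> R.
Hypotheses (phi_smooth : smooth_on_sphere phi) (phi_pos : positive_on_sphere phi).
Local Notation H := (hsupport phi).
Let sH := smooth_support phi_smooth.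
Variable x : E.
Hypothesis x1 : sphere R n x.
Let x0 : x != 0 := sphere_neq0 x1.
Local Notation b i := (row i (householder x)).
Local Notation K := (grad_sqr H x + 1).

(** The first derivative of |DH|^2 along u, with [gradDD] the second one. The basis consists of x
    and its frame and stays constant along the line, so that the radial contribution can be split
    off and evaluated by homogeneity. *)
Definition gradD (u : E) : R := 2 * \sum_i 'D_(b i) H x * 'D_u ('D_(b i) H) x.

Definition gradDD (u : E) : R :=
  2 * \sum_i (('D_u ('D_(b i) H) x) ^+ 2 + 'D_(b i) H x * 'D_u ('D_u ('D_(b i) H)) x).

Lemma jet2_grad_sqr (u : E) :
  jet2 (fun t => grad_sqr H (x + t *: u) + 1) K (gradD u) (gradDD u).
Proof.
have Ji i := jet2_line u open_punctured (smooth_derive (b i) sH) x0.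
have J := jet2D (jet2_sum (fun i => jet2M (Ji i) (Ji i))) (jet2_cst 1).
have gE (y : E) : y != 0 -> \sum_i 'D_(b i) H y * 'D_(b i) H y + 1 = grad_sqr H y + 1.
  move=> y0; apply: (congr1 (fun s => s + 1)); apply: etrans (esym _).
    by apply: eq_bigr => i _; rewrite -expr2.
  exact: grad_sqr_orthonormal sH y0 (householder_orthogonal x).
have nE : \forall t \near (0 : R),
    \sum_i 'D_(b i) H (x + t *: u) * 'D_(b i) H (x + t *: u) + 1
      = grad_sqr H (x + t *: u) + 1.
  by apply: filterS (near_line_punctured u x0) => t; exact: gE.
apply: (jet2_eqv (jet2_near nE J)).
- exact: gE.
- rewrite addr0 /gradD mulr_sumr; apply: eq_bigr => i _.
  by move: ('D_(b i) H x) ('D_u ('D_(b i) H) x) => p q; ring.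
- rewrite addr0 /gradDD mulr_sumr; apply: eq_bigr => i _.
  move: ('D_u ('D_u ('D_(b i) H)) x) ('D_u ('D_(b i) H) x) ('D_(b i) H x) => r q p.
  by ring.
Qed.

Section Along.
Hypothesis phi_hconvex : h_convex phi.
Variable xi : E.
Hypotheses (xi1 : dot xi xi = 1) (xi_x : dot xi x = 0).
Hypothesis xi_null : 2 * phi x * 'D_xi ('D_xi H) x = K.
Variables u V : E.
Hypotheses (u_x : dot u x = 0) (V_x : dot V x = 0).

(* The quadratic form of [support_hconvex] at [x + t u], evaluated on [xi + t V]:
   it is nonnegative and vanishes at [t = 0]. *)
Let defect t : R :=
  let y := x + t *: u in
  2 * (H y * ('D_xi ('D_xi H) y + (2 * (t * 'D_xi ('D_V H) y) + t * t * 'D_V ('D_V H) y)))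
  + - 1 * ((grad_sqr H y + 1) *
     (1 + t * (2 * dot xi V) + t * t * dot V V
       + - 1 * ((t * dot xi u + t * t * dot V u) * (t * dot xi u + t * t * dot V u)))).

Let defect_ge0 : \forall t \near (0 : R), 0 <= defect t.
Proof.
apply: filterS (near_line_punctured u x0) => t y0.
pose y := x + t *: u; pose v := t *: V + xi.
have := support_hconvex phi_smooth phi_pos phi_hconvex v y0; rewrite -/y.
have -> : dot v y = t * dot xi u + t * t * dot V u.
  by rewrite !(dotDl, dotDr, dotZl, dotZr) xi_x V_x; ring.
have -> : dot v v = 1 + t * (2 * dot xi V) + t * t * dot V V.
  by rewrite !(dotDl, dotDr, dotZl, dotZr) xi1 (dotC V xi); ring.
have xx : dot x x = 1 by [].
have -> : dot y y = 1 + t * t * dot u u.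
  by rewrite !(dotDl, dotDr, dotZl, dotZr) u_x (dotC x u) u_x xx; ring.
have -> : 'D_v ('D_v H) y =
    'D_xi ('D_xi H) y + (2 * (t * 'D_xi ('D_V H) y) + t * t * 'D_V ('D_V H) y).
  exact: (derive2_quadratic open_punctured sH t V xi y0).
have uu0 : 0 <= t * t * dot u u by rewrite mulr_ge0 ?dot_ge0 // -expr2 sqr_ge0.
have G0 : 0 <= grad_sqr H y by apply: sumr_ge0 => i _; rewrite sqr_ge0.
rewrite /defect -/y; move: uu0 G0; move: (grad_sqr H y) => G.
move: (t * t * dot u u) (t * dot xi u + _) (1 + t * _ + _) => U a S.
move: (H y) ('D_xi _ _ + _) => h D hle U0 G0.
have a20 : 0 <= a ^+ 2 by exact: sqr_ge0.
have U1 : 0 < 1 + U by lra.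
(* With |y|^2 = 1 + U, [defect] is the form of [support_hconvex] divided by |y|^2, plus a term that
   is nonnegative and of order t^4. It thus has the same 2-jet and is polynomial in its
   ingredients. *)
have -> : 2 * (h * D) + -1 * ((G + 1) * (S + -1 * (a * a))) =
  (1 + U)^-1 * ((2 * h * (1 + U) * D - (G + 1) * ((1 + U) * S - a ^+ 2))
     + (G + 1) * U * a ^+ 2).
  by field; rewrite gt_eqF.
apply: mulr_ge0; first by rewrite invr_ge0 ltW.
apply: addr_ge0; first by rewrite subr_ge0.
by apply: mulr_ge0 => //; apply: mulr_ge0 => //; lra.
Qed.

(** At its minimum t = 0, [defect] has zero first derivative and nonnegative second derivative. The
    direction u of the base point and the variation V of the vector are independent. *)
Lemma second_order_test :
  2 * 'D_u H x * 'D_xi ('D_xi H) x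
    + 2 * phi x * ('D_u ('D_xi ('D_xi H)) x + 2 * 'D_xi ('D_V H) x)
    = gradD u + 2 * K * dot xi V
  /\
  gradDD u + 4 * gradD u * dot xi V + 2 * K * (dot V V - dot xi u ^+ 2) <=
  2 * ('D_u ('D_u H) x * 'D_xi ('D_xi H) x
    + 2 * 'D_u H x * ('D_u ('D_xi ('D_xi H)) x + 2 * 'D_xi ('D_V H) x)
    + phi x * ('D_u ('D_u ('D_xi ('D_xi H))) x + 4 * 'D_u ('D_xi ('D_V H)) x
       + 2 * 'D_V ('D_V H) x)).
Proof.
have J := jet2_test (dot xi V) (dot V V) (dot V u) (dot xi u)
  (jet2_line u open_punctured sH x0)
  (jet2_line u open_punctured (smooth_derive xi (smooth_derive xi sH)) x0)
  (jet2_line u open_punctured (smooth_derive xi (smooth_derive V sH)) x0)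
  (jet2_line u open_punctured (smooth_derive V (smooth_derive V sH)) x0)
  (jet2_grad_sqr u).
rewrite (support_sphere phi x1) xi_null subrr in J.
have [/eqP + h] := jet2_min J defect_ge0; rewrite subr_eq0 => /eqP h1.
by split; [exact: h1 | rewrite -subr_ge0; exact: h].
Qed.

End Along.
End SecondOrderTest.

(** * Summation of the tests over the frame and the resulting algebra *)

Lemma sum_of_tests {R : realType} n
    (c p hh t q s r mu hmu gd gdd : 'I_n -> R)
    (K phi lam eta m hmm mm : R) :
  (forall k, gdd k + 4 * gd k * (c k * (m - lam))
      + 2 * K * (lam ^+ 2 - 2 * lam * c k * mu k + c k ^+ 2 * mm - c k ^+ 2) <=
    2 * (hh k * eta + 2 * p k * (t k + 2 * (eta * (c k * (m - lam))))
      + phi * (q k + 4 * (c k * r k - lam * s k)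
         + 2 * (lam ^+ 2 * hh k - 2 * lam * c k * hmu k + c k ^+ 2 * hmm)))) ->
  \sum_k gdd k + 4 * (m - lam) * (\sum_k c k * gd k)
      + 2 * K * (n%:R * lam ^+ 2 - 2 * lam * (\sum_k c k * mu k)
           + (mm - 1) * \sum_k c k ^+ 2) <=
  2 * eta * (\sum_k hh k) + 4 * (\sum_k p k * t k)
    + 8 * eta * (m - lam) * (\sum_k c k * p k) + 2 * phi * (\sum_k q k)
    + 8 * phi * (\sum_k c k * r k) - 8 * phi * lam * (\sum_k s k)
    + 4 * phi * lam ^+ 2 * (\sum_k hh k) - 8 * phi * lam * (\sum_k c k * hmu k)
    + 4 * phi * hmm * (\sum_k c k ^+ 2).
Proof.
elim: n c p hh t q s r mu hmu gd gdd => [|n IH] c p hh t q s r mu hmu gd gdd ineq.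
  by rewrite !big_ord0; nra.
have := IH _ _ _ _ _ _ _ _ _ _ _ (fun k => ineq (lift ord0 k)).
have := ineq ord0; rewrite !big_ord_recl -natr1.
repeat (match goal with |- context [\sum_(i < n) ?F i] => move: (\sum_(i < n) F i) => ? end).
lra.
Qed.

(** From |h - eta I|^2 >= 0, discarding the off-diagonal entries. For h = D^2 H on tangent vectors
    and eta = (|DH|^2 + 1)/(2H), the matrix h - eta I is U. *)
Lemma sum_sqr_ge {R : realType} n (h : 'I_n -> 'I_n -> R) (eta : R) :
  2 * eta * (\sum_k h k k) - n%:R * eta ^+ 2 <= \sum_k \sum_l h k l ^+ 2.
Proof.
have -> : n%:R * eta ^+ 2 = \sum_(k < n) eta ^+ 2.
  by rewrite sumr_const card_ord mulr_natl.
rewrite mulr_sumr -sumrB; apply: ler_sum => k _.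
apply: (@le_trans _ _ (h k k ^+ 2)).
  by have := sqr_ge0 (h k k - eta); rewrite sqrrB; lra.
by rewrite (bigD1 k) //= lerDl sumr_ge0 // => l _; rewrite sqr_ge0.
Qed.

(* [lam] is chosen to minimise the quadratic polynomial in [lam] that the
   summed second-order test produces. *)
Lemma summed_test_conclusion {R : realType}
    (n phi f T K eta px P2 hPP hPxx Lx LP L2 HS fx fP fxx : R) :
  let lam := fx / f - px / phi in let m := - px / phi in
  0 < phi -> 0 < f ->
  eta = K / (2 * phi) -> K = P2 + phi ^+ 2 + 1 ->
  phi * T = n / 2 * K + f ->
  px * T + phi * Lx = n / 2 * (2 * (eta * px)) + fx ->
  P2 * T + phi * LP = n / 2 * (2 * hPP) + fP ->
  eta * T + 2 * px * Lx + phi * (L2 + 2 * eta)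
    = n / 2 * (2 * (eta ^+ 2 + hPxx - phi * eta)) + fxx ->
  2 * P2 * eta + 2 * phi * hPxx = 2 * hPP ->
  2 * eta * T - n * eta ^+ 2 <= HS ->
  2 * (HS + LP - phi * T) + 4 * (m - lam) * (2 * (eta * px))
      + 2 * K * (n * lam ^+ 2 - 2 * lam * m + (P2 / phi ^+ 2 - 1) * 1) <=
  2 * eta * T + 4 * hPxx + 8 * eta * (m - lam) * px + 2 * phi * L2
    + 8 * phi * (- (hPxx / phi)) - 8 * phi * lam * Lx
    + 4 * phi * lam ^+ 2 * T - 8 * phi * lam * (eta * m)
    + 4 * phi * (hPP / phi ^+ 2) * 1 ->
  0 <= fxx - 2 * fx ^+ 2 / f + (2 * fx * px - fP) / phi - f / phi ^+ 2.
Proof.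
move=> lam m phi0 f0 etaE KE E0 E1 EP E2 B2 HSle test.
have pn : phi != 0 by rewrite gt_eqF.
have fn : f != 0 by rewrite gt_eqF.
have TE : T = (n / 2 * K + f) / phi by rewrite -E0; field.
have LxE : Lx = (n * eta * px + fx - px * T) / phi.
  by apply: (mulfI pn); rewrite mulrCA mulfV // mulr1; lra.
have hPPE : hPP = P2 * eta + phi * hPxx by lra.
have LPE : LP = (n * hPP + fP - P2 * T) / phi.
  by apply: (mulfI pn); rewrite mulrCA mulfV // mulr1; lra.
have L2E : L2 = (n * (eta ^+ 2 + hPxx - phi * eta) + fxx - eta * T - 2 * px * Lx) / phi
    - 2 * eta.
  apply: (mulfI pn); rewrite mulrBr mulrCA mulfV // mulr1; lra.
rewrite -subr_ge0 in test; rewrite -subr_ge0 in HSle.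
set G := (X in 0 <= X).
(* The differentiated equation has eliminated the traces. What remains is an identity: twice the
   target is the slack of the summed test plus twice the slack of [HSle]. Both [HS] and the third
   derivative [hPxx] cancel. *)
suff id : 2 * G = (2 * eta * T + 4 * hPxx + 8 * eta * (m - lam) * px + 2 * phi * L2
    + 8 * phi * (- (hPxx / phi)) - 8 * phi * lam * Lx
    + 4 * phi * lam ^+ 2 * T - 8 * phi * lam * (eta * m)
    + 4 * phi * (hPP / phi ^+ 2) * 1
    - (2 * (HS + LP - phi * T) + 4 * (m - lam) * (2 * (eta * px))
      + 2 * K * (n * lam ^+ 2 - 2 * lam * m + (P2 / phi ^+ 2 - 1) * 1)))
   + 2 * (HS - (2 * eta * T - n * eta ^+ 2)).
  by rewrite -(pmulr_rge0 _ (ltr0n R 2)) id addr_ge0 // mulr_ge0.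
rewrite /G L2E LPE LxE hPPE TE etaE KE /lam /m; field.
by rewrite pn fn.
Qed.

(** * Radial and tangential parts of the twice differentiated equation *)

Section TangentialIdentities.
Context {R : realType} {n : nat}.
Local Notation E := 'rV[R]_n.+1.
Local Notation punctured := [set y : E | y != 0].
Variable phi : E -> R.
Hypotheses (phi_smooth : smooth_on_sphere phi) (phi_pos : positive_on_sphere phi).
Local Notation H := (hsupport phi).
Let sH := smooth_support phi_smooth.
Variable x : E.
Hypothesis x1 : sphere R n x.
Let x0 : x != 0 := sphere_neq0 x1.
Local Notation b k := (frame x k).
Local Notation K := (grad_sqr H x + 1).
Local Notation gradD := (gradD phi x).
Local Notation gradDD := (gradDD phi x).

(** The vector Dphi at x, frozen as a constant ambient vector so that differentiation along it can
    be iterated and commuted. *)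
Definition tgrad : E := tang x (\row_k 'D_(b k) H x).
Local Notation P := tgrad.

Lemma derive_tang (G : E -> R) c : smooth_on punctured G ->
  'D_(tang x c) G x = \sum_k c 0 k * 'D_(b k) G x.
Proof. by move=> sG; exact: derive_sumv sG x0. Qed.

Lemma derive_tgrad (G : E -> R) : smooth_on punctured G ->
  'D_P G x = \sum_k 'D_(b k) H x * 'D_(b k) G x.
Proof.
move=> sG; apply: etrans (derive_tang _ sG) _.
by apply: eq_bigr => k _; rewrite mxE.
Qed.

Lemma gradD_tgrad (u : E) : gradD u = 2 * 'D_u ('D_P H) x.
Proof.
congr (2 * _).
apply: etrans (sum_row_householder (fun w => 'D_w H x * 'D_u ('D_w H) x) x1) _.
have e : 'D_u ('D_x H) x = 0 := derive2_support_radialr phi_smooth u x0.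
apply: etrans (congr1 (fun s => _ * s + _) e) _; rewrite mulr0 add0r.
apply: etrans _ (esym (derive_comm u P open_punctured sH x0)).
apply: etrans _ (esym (derive_tgrad (smooth_derive u sH))).
apply: eq_bigr => k _; apply: (congr1 (fun s => _ * s)).
exact: derive_comm open_punctured sH x0.
Qed.

(** The last term comes from the radial basis vector: differentiating H along x and twice along u
    gives minus the second derivative along u, since D^2 H has degree -1. *)
Lemma gradDD_tgrad (u : E) : gradDD u =
  2 * (\sum_k ('D_u ('D_(b k) H) x) ^+ 2 + 'D_P ('D_u ('D_u H)) x
       - phi x * 'D_u ('D_u H) x).
Proof.
congr (2 * _).
apply: etrans (sum_row_householder (fun w => ('D_u ('D_w H) x) ^+ 2 +
  'D_w H x * 'D_u ('D_u ('D_w H)) x) x1) _.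
have e1 : 'D_u ('D_x H) x = 0 := derive2_support_radialr phi_smooth u x0.
have e2 : 'D_u ('D_u ('D_x H)) x = - 'D_u ('D_u H) x.
  apply: etrans (derive3_comm23 open_punctured sH u u x x0) _.
  apply: etrans (derive3_comm12 open_punctured sH u x u x0) _.
  exact (derive3_support_radial phi_smooth u u x0).
have e3 : 'D_x H x = phi x := derive_support_radial phi_smooth x1.
have e4 : \sum_k (('D_u ('D_(b k) H) x) ^+ 2 + 'D_(b k) H x * 'D_u ('D_u ('D_(b k) H)) x)
    = \sum_k ('D_u ('D_(b k) H) x) ^+ 2 + 'D_P ('D_u ('D_u H)) x.
  rewrite big_split; apply: (congr1 (fun s => _ + s)).
  apply: etrans _ (esym (derive_tgrad (smooth_derive u (smooth_derive u sH)))).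
  apply: eq_bigr => k _; apply: (congr1 (fun s => _ * s)).
  apply: etrans (derive3_comm23 open_punctured sH u u (b k) x0) _.
  exact (derive3_comm12 open_punctured sH u (b k) u x0).
have alg (a1 a2 a3 a4 s d h : R) : a1 = 0 -> a2 = - h -> a3 = phi x -> a4 = s + d ->
    a1 ^+ 2 + a3 * a2 + a4 = s + d - phi x * h.
  by move=> -> -> -> ->; ring.
exact: alg e1 e2 e3 e4.
Qed.

Lemma grad_sqr_tgrad : K = 'D_P H x + phi x ^+ 2 + 1.
Proof.
apply: (congr1 (fun s => s + 1)).
apply: etrans (grad_sqr_orthonormal sH x0 (householder_orthogonal x)) _.
apply: etrans (sum_row_householder (fun w => ('D_w H x) ^+ 2) x1) _.
rewrite addrC (derive_support_radial phi_smooth x1); apply: (congr1 (fun s => s + _)).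
apply: etrans _ (esym (derive_tgrad sH)).
by apply: eq_bigr => k _; rewrite expr2.
Qed.

Section Equation.
Variable f : E -> R.
Hypothesis f_smooth : smooth_on_sphere f.
Hypothesis phi_eq : forall x, sphere R n x ->
      laplacian phi x - n%:R / 2 * (enorm (grad phi x) ^+ 2 / phi x)
        + n%:R / 2 * (phi x - (phi x)^-1)
      = (phi x)^-1 * f x.

Definition trace0 : R := \sum_k 'D_(b k) ('D_(b k) H) x.
Definition trace1 (u : E) : R := \sum_k 'D_u ('D_(b k) ('D_(b k) H)) x.
Definition trace2 (u : E) : R := \sum_k 'D_u ('D_u ('D_(b k) ('D_(b k) H))) x.

(** The traces run over tangent vectors only. The missing radial vector contributes nothing to the
    value and the first derivative, but since D^2 H has degree -1, two radial derivatives multiply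
    it by (-1)(-2) = 2 in the second. *)
Lemma jet2_lap (u : E) :
  jet2 (fun t => ambient_lap H (x + t *: u)) trace0 (trace1 u)
    (trace2 u + 2 * 'D_u ('D_u H) x).
Proof.
pose r i := row i (householder x).
have Ji i := jet2_line u open_punctured (smooth_derive (r i) (smooth_derive (r i) sH)) x0.
have nE : \forall t \near (0 : R),
    \sum_i 'D_(r i) ('D_(r i) H) (x + t *: u) = ambient_lap H (x + t *: u).
  apply: filterS (near_line_punctured u x0) => t y0.
  apply: esym.
  exact: ambient_lap_orthonormal open_punctured sH y0 (householder_orthogonal x).
apply: (jet2_eqv (jet2_near nE (jet2_sum Ji))).
- apply: etrans (sum_row_householder (fun w => 'D_w ('D_w H) x) x1) _.
  have e : 'D_x ('D_x H) x = 0 := derive2_support_radial phi_smooth x x0.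
  exact (etrans (congr1 (fun s => s + _) e) (add0r _)).
- apply: etrans (sum_row_householder (fun w => 'D_u ('D_w ('D_w H)) x) x1) _.
  have e : 'D_u ('D_x ('D_x H)) x = 0.
    apply: etrans (derive3_comm12 open_punctured sH u x x x0) _.
    apply: etrans (derive3_comm23 open_punctured sH x u x x0) _.
    apply: etrans (derive3_support_radial phi_smooth x u x0) _.
    exact (etrans (congr1 -%R (derive2_support_radial phi_smooth u x0)) (oppr0 _)).
  exact (etrans (congr1 (fun s => s + _) e) (add0r _)).
- apply: etrans (sum_row_householder (fun w => 'D_u ('D_u ('D_w ('D_w H))) x) x1) _.
  have e : 'D_u ('D_u ('D_x ('D_x H))) x = 2 * 'D_u ('D_u H) x.
    apply: etrans (derive4_comm open_punctured sH u x x0) _.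
    exact (derive4_support_radial phi_smooth u u x0).
  exact (etrans (congr1 (fun s => s + _) e) (addrC _ _)).
Qed.

(** The two sides of [support_equation] agree near x on the line in direction u, hence have the same
    2-jet. *)
Lemma equation_jets (u : E) :
  [/\ phi x * trace0 = n%:R / 2 * K + f x,
    'D_u H x * trace0 + phi x * trace1 u = n%:R / 2 * gradD u + 'D_u (rext f) x
  & 'D_u ('D_u H) x * trace0 + 2 * 'D_u H x * trace1 u
     + phi x * (trace2 u + 2 * 'D_u ('D_u H) x)
    = n%:R / 2 * gradDD u + 'D_u ('D_u (rext f)) x].
Proof.
have Jcst (k : R -> R) (c k0 k1 k2 : R) : jet2 k k0 k1 k2 ->
    jet2 (fun t => c * k t) (c * k0) (c * k1) (c * k2).
  by move=> Jk; apply: (jet2_eqv (jet2M (jet2_cst c) Jk)); ring.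
have J1 := jet2M (jet2_eqv (jet2_line u open_punctured sH x0)
  (support_sphere phi x1) erefl erefl) (jet2_lap u).
have J2 := jet2D (Jcst _ (n%:R / 2) _ _ _ (jet2_grad_sqr phi_smooth x1 u))
  (jet2_eqv (jet2_line u open_punctured f_smooth x0) (rext_sphere f x1) erefl erefl).
have nE : \forall t \near (0 : R),
    H (x + t *: u) * ambient_lap H (x + t *: u) =
    n%:R / 2 * (grad_sqr H (x + t *: u) + 1) + rext f (x + t *: u).
  apply: filterS (near_line_punctured u x0) => t y0.
  exact (support_equation phi_smooth phi_pos phi_eq y0).
by have [] := jet2_unique (jet2_near nE J1) J2.
Qed.

End Equation.
End TangentialIdentities.

Lemma dot_comb {R : realType} m (a d : R) (v w : 'rV[R]_m) :
  dot (a *: v + d *: w) (a *: v + d *: w) =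
    a ^+ 2 * dot v v + 2 * a * d * dot v w + d ^+ 2 * dot w w.
Proof. by rewrite !(dotDl, dotDr, dotZl, dotZr) (dotC w v); ring. Qed.

Section TwoTermCombinations.
Context {R : realType} {n : nat}.
Local Notation E := 'rV[R]_n.+1.
Variables (A : set E) (F : E -> R).
Hypothesis sF : smooth_on A F.
Implicit Types (u v w x : E).

Lemma derive_comb (a d : R) v w x : A x ->
  'D_(a *: v + d *: w) F x = a * 'D_v F x + d * 'D_w F x.
Proof.
move=> Ax; have dF := smooth_differentiable sF Ax.
by rewrite !deriveE // linearD !linearZ.
Qed.

End TwoTermCombinations.

Section TwoTermQuadratic.
Context {R : realType} {n : nat}.
Local Notation E := 'rV[R]_n.+1.
Variables (A : set E) (F : E -> R).
Hypotheses (oA : open A) (sF : smooth_on A F).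

Lemma derive2_combr (a d : R) (u v w x : E) : A x ->
  'D_u ('D_(a *: v + d *: w) F) x = a * 'D_u ('D_v F) x + d * 'D_u ('D_w F) x.
Proof.
move=> Ax; apply: etrans (derive_comm u (a *: v + d *: w) oA sF Ax) _.
apply: etrans (derive_comb (smooth_derive u sF) a d v w Ax) _.
exact (congr2 (fun p q => a * p + d * q)
  (derive_comm v u oA sF Ax) (derive_comm w u oA sF Ax)).
Qed.

Lemma derive2_comb (a d : R) (v w x : E) : A x ->
  'D_(a *: v + d *: w) ('D_(a *: v + d *: w) F) x =
    a ^+ 2 * 'D_v ('D_v F) x + 2 * a * d * 'D_v ('D_w F) x + d ^+ 2 * 'D_w ('D_w F) x.
Proof.
move=> Ax; apply: etrans (derive_comb (smooth_derive (a *: v + d *: w) sF) a d v w Ax) _.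
apply: etrans (congr2 (fun p q => a * p + d * q)
  (derive2_combr a d v v w Ax) (derive2_combr a d w v w Ax)) _.
have alg (p q r s : R) : q = r ->
    a * (a * p + d * q) + d * (a * r + d * s) = a ^+ 2 * p + 2 * a * d * q + d ^+ 2 * s.
  by move=> ->; ring.
exact (alg _ _ _ _ (derive_comm v w oA sF Ax)).
Qed.

End TwoTermQuadratic.

(** * Arithmetic of the tests, with variables in place of iterated derivatives *)

Lemma test_null_direction {R : realFieldType} (p h d1 d2 g k s q : R) :
  p != 0 -> d1 = 0 -> d2 = 0 -> g = 0 ->
  2 * d1 * h + 2 * p * (d2 + 2 * q) = g + 2 * k * s -> q = k / (2 * p) * s.
Proof.
move=> p0 -> -> -> e; have ks : k * s = 2 * p * q by lra.
by rewrite mulrAC ks; field.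
Qed.

Lemma test_first_order {R : realFieldType} (p h d1 d2 g k s q e : R) :
  p != 0 -> h = e -> e = k / (2 * p) -> q = e * s ->
  2 * d1 * h + 2 * p * (d2 + 2 * q) = g + 2 * k * s -> 2 * d1 * e + 2 * p * d2 = g.
Proof.
move=> p0 -> eE -> T; have kE : k = 2 * p * e by rewrite eE; field.
by rewrite kE in T; lra.
Qed.

Lemma test_expand {R : realFieldType}
    (gdd gd K s vv ck hk h pk t d q d3 d2 p l m A1 A2 A3 A4 A5 A6 e : R) :
  s = ck * (m - l) -> vv = A1 -> h = e -> d = e * (ck * (m - l)) ->
  d3 = - l * A2 + ck * A3 ->
  d2 = (- l) ^+ 2 * A4 + 2 * (- l) * ck * A5 + ck ^+ 2 * A6 ->
  gdd + 4 * gd * s + 2 * K * (vv - ck ^+ 2) <=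
    2 * (hk * h + 2 * pk * (t + 2 * d) + p * (q + 4 * d3 + 2 * d2)) ->
  gdd + 4 * gd * (ck * (m - l)) + 2 * K * (A1 - ck ^+ 2) <=
    2 * (hk * e + 2 * pk * (t + 2 * (e * (ck * (m - l))))
      + p * (q + 4 * (ck * A3 - l * A2) + 2 * (l ^+ 2 * A4 - 2 * l * ck * A5 + ck ^+ 2 * A6))).
Proof. by move=> -> -> -> -> -> -> T; lra. Qed.

Lemma sum_of_tests_eq {R : realType} n
    (c p hh t q s r mu hmu gd gdd : 'I_n -> R)
    (K phi lam eta m hmm mm m' hmm' mm' Sgdd Sgd Smu Sc Shh Spt Scp Sq Sr Ss Sh : R) :
  m = m' -> hmm = hmm' -> mm = mm' ->
  \sum_k gdd k = Sgdd -> \sum_k c k * gd k = Sgd -> \sum_k c k * mu k = Smu ->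
  \sum_k c k ^+ 2 = Sc -> \sum_k hh k = Shh -> \sum_k p k * t k = Spt ->
  \sum_k c k * p k = Scp -> \sum_k q k = Sq -> \sum_k c k * r k = Sr ->
  \sum_k s k = Ss -> \sum_k c k * hmu k = Sh ->
  (forall k, gdd k + 4 * gd k * (c k * (m - lam))
      + 2 * K * (lam ^+ 2 - 2 * lam * c k * mu k + c k ^+ 2 * mm - c k ^+ 2) <=
    2 * (hh k * eta + 2 * p k * (t k + 2 * (eta * (c k * (m - lam))))
      + phi * (q k + 4 * (c k * r k - lam * s k)
         + 2 * (lam ^+ 2 * hh k - 2 * lam * c k * hmu k + c k ^+ 2 * hmm)))) ->
  Sgdd + 4 * (m' - lam) * Sgd
      + 2 * K * (n%:R * lam ^+ 2 - 2 * lam * Smu + (mm' - 1) * Sc) <=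
  2 * eta * Shh + 4 * Spt + 8 * eta * (m' - lam) * Scp + 2 * phi * Sq
    + 8 * phi * Sr - 8 * phi * lam * Ss
    + 4 * phi * lam ^+ 2 * Shh - 8 * phi * lam * Sh + 4 * phi * hmm' * Sc.
Proof.
by move=> <- <- <- <- <- <- <- <- <- <- <- <- <- <-; exact: sum_of_tests.
Qed.

(** * The inequality for f at a null vector *)

Section SecondOrderInequality.
Context {R : realType} {n : nat}.
Local Notation E := 'rV[R]_n.+1.
Local Notation punctured := [set y : E | y != 0].
Variables f phi : E -> R.
Hypotheses (f_smooth : smooth_on_sphere f) (f_pos : positive_on_sphere f).
Hypotheses (phi_smooth : smooth_on_sphere phi) (phi_pos : positive_on_sphere phi).
Hypothesis phi_hconvex : h_convex phi.
Hypothesis phi_eq : forall x, sphere R n x ->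
      laplacian phi x - n%:R / 2 * (enorm (grad phi x) ^+ 2 / phi x)
        + n%:R / 2 * (phi x - (phi x)^-1)
      = (phi x)^-1 * f x.
Local Notation H := (hsupport phi).
Let sH := smooth_support phi_smooth.
Variable x : E.
Hypothesis x1 : sphere R n x.
Let x0 : x != 0 := sphere_neq0 x1.
Local Notation b k := (frame x k).
Local Notation K := (grad_sqr H x + 1).
Local Notation P := (tgrad phi x).
Variable c : 'rV[R]_n.
Hypothesis c1 : dot c c = 1.
Local Notation xi := (tang x c).
Hypothesis xi_null : 2 * phi x * 'D_xi ('D_xi H) x = K.

Let xi_x : dot xi x = 0 := dot_tang_base c x1.
Let xi1 : dot xi xi = 1. Proof. exact: (etrans (dot_tang x c c) c1). Qed.
Let P_x : dot P x = 0 := dot_tang_base _ x1.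
Let eta := K / (2 * phi x).

Let phi0 : phi x != 0. Proof. by rewrite gt_eqF // phi_pos. Qed.

Let etaE : 'D_xi ('D_xi H) x = eta.
Proof.
have alg (p h k : R) : p != 0 -> 2 * p * h = k -> h = k / (2 * p).
  by move=> p0 <-; field.
exact (alg _ _ _ phi0 xi_null).
Qed.

(** The first-order test with u = 0 moves only the vector: a null vector of a nonnegative quadratic
    form lies in its kernel, so xi is an eigenvector of D^2 H. *)
Let null_dir (V : E) : dot V x = 0 -> 'D_xi ('D_V H) x = eta * dot xi V.
Proof.
move=> Vx.
have [T1 _] := second_order_test phi_smooth phi_pos x1 phi_hconvex xi1 xi_x xi_null
  (dot0l x) Vx.
have d0 G : 'D_(0 : E) G x = 0 :> R by exact: derive0.
have g0 : gradD phi x 0 = 0.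
  by apply: etrans (gradD_tgrad phi_smooth x1 0) _; rewrite d0 mulr0.
exact (test_null_direction phi0 (d0 _) (d0 _) g0 T1).
Qed.

(** By [null_dir] the terms in V of the first-order test cancel, so any tangential V would do; V = u
    is taken. *)
Let null_derive (u : E) : dot u x = 0 ->
  2 * 'D_u H x * eta + 2 * phi x * 'D_u ('D_xi ('D_xi H)) x = gradD phi x u.
Proof.
move=> ux.
have [T1 _] := second_order_test phi_smooth phi_pos x1 phi_hconvex xi1 xi_x xi_null
  ux ux.
exact (test_first_order phi0 etaE erefl (null_dir ux) T1).
Qed.

(** With this value the test field has covariant derivative -(f_xi/f) I for the metric phi^-2 g, up
    to a multiple of xi, which does not matter as xi is null. The term phi_xi/phi converts from that
    connection to the round one. *)
Let lam := 'D_xi (rext f) x / f x - 'D_xi H x / phi x.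
Let mu : E := - (phi x)^-1 *: P.
Let mu_x : dot mu x = 0. Proof. by rewrite dotZl P_x mulr0. Qed.
Let m := dot xi mu.
(* The first derivatives of the test field: [mu] corrects for the Levi-Civita
   connection of the conformal metric, and the multiple [lam] of the identity makes
   the divergence of the tensor, which is the differential of [f], appear. *)
Let V k : E := (- lam) *: b k + c 0 k *: mu.

Let xi_b k : dot xi (b k) = c 0 k. Proof. exact: dot_tang_frame. Qed.

Let test_k k :
  gradDD phi x (b k) + 4 * gradD phi x (b k) * (c 0 k * (m - lam))
      + 2 * K * (lam ^+ 2 - 2 * lam * c 0 k * dot (b k) mu + c 0 k ^+ 2 * dot mu mu
                 - c 0 k ^+ 2) <=
  2 * ('D_(b k) ('D_(b k) H) x * eta
    + 2 * 'D_(b k) H x * ('D_(b k) ('D_xi ('D_xi H)) x + 2 * (eta * (c 0 k * (m - lam))))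
    + phi x * ('D_(b k) ('D_(b k) ('D_xi ('D_xi H))) x
       + 4 * (c 0 k * 'D_(b k) ('D_mu ('D_xi H)) x - lam * 'D_(b k) ('D_(b k) ('D_xi H)) x)
       + 2 * (lam ^+ 2 * 'D_(b k) ('D_(b k) H) x - 2 * lam * c 0 k * 'D_(b k) ('D_mu H) x
              + c 0 k ^+ 2 * 'D_mu ('D_mu H) x))).
Proof.
have bx : dot (b k) x = 0 := frame_tangent k x1.
have Vx : dot (V k) x = 0 by rewrite dotDl (dotZl (- lam)) (dotZl (c 0 k)) bx mu_x !mulr0 addr0.
have [_ T2] := second_order_test phi_smooth phi_pos x1 phi_hconvex xi1 xi_x xi_null bx Vx.
have xiV : dot xi (V k) = c 0 k * (m - lam).
  by rewrite /V dotDr (dotZr (- lam)) (dotZr (c 0 k)) xi_b -/m; ring.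
have VV : dot (V k) (V k) =
    lam ^+ 2 - 2 * lam * c 0 k * dot (b k) mu + c 0 k ^+ 2 * dot mu mu.
  have bb : dot (b k) (b k) = 1 by rewrite frame_orthonormal eqxx.
  by apply: etrans (dot_comb _ _ _ _) _; rewrite bb; ring.
have e1 : 'D_xi ('D_(V k) H) x = eta * (c 0 k * (m - lam)).
  by apply: etrans (null_dir Vx) _; rewrite xiV.
have e2 : 'D_(b k) ('D_xi ('D_(V k) H)) x =
    - lam * 'D_(b k) ('D_(b k) ('D_xi H)) x + c 0 k * 'D_(b k) ('D_mu ('D_xi H)) x.
  apply: etrans (derive3_comm23 open_punctured sH (b k) xi (V k) x0) _.
  exact (derive2_combr open_punctured (smooth_derive xi sH) (- lam) (c 0 k) (b k) (b k) mu x0).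
have e3 := derive2_comb open_punctured sH (- lam) (c 0 k) (b k) mu x0.
rewrite -/(V k) in e3.
rewrite xi_b in T2.
exact (test_expand xiV VV etaE e1 e2 e3 T2).
Qed.

Let P_sqr : dot P P = 'D_P H x.
Proof.
apply: etrans (dot_tang _ _ _) (esym _).
refine (etrans (derive_tgrad phi x1 sH) _).
by apply: eq_bigr => k _; rewrite !mxE.
Qed.

Let xi_P : dot xi P = 'D_xi H x.
Proof.
apply: etrans (dot_tang _ _ _) (esym _).
refine (etrans (derive_tang x1 c sH) _).
by apply: eq_bigr => k _; rewrite mxE.
Qed.

Let mE : m = - 'D_xi H x / phi x.
Proof.
by apply: etrans (dotZr _ _ _) _; rewrite xi_P mulrC mulrN mulNr.
Qed.

Let mu_sqr : dot mu mu = 'D_P H x / phi x ^+ 2.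
Proof.
have e : dot mu mu = - (phi x)^-1 * (- (phi x)^-1 * dot P P).
  by rewrite -dotZr -dotZl.
by rewrite e P_sqr; move: phi0 => p0; field.
Qed.

Let derive_mu (G : E -> R) : smooth_on punctured G -> 'D_mu G x = - ('D_P G x / phi x).
Proof.
move=> sG; have dG := smooth_differentiable sG x0.
have e : 'D_mu G x = - (phi x)^-1 * 'D_P G x.
  by rewrite !deriveE // linearZ.
by rewrite e mulNr mulrC.
Qed.

Let derive_xi (G : E -> R) : smooth_on punctured G ->
  'D_xi G x = \sum_k c 0 k * 'D_(b k) G x.
Proof. by move=> sG; exact (derive_tang x1 c sG). Qed.

Let sum_gdd : \sum_k gradDD phi x (b k) =
  2 * (\sum_k \sum_l ('D_(b k) ('D_(b l) H) x) ^+ 2 + trace1 phi x P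
       - phi x * trace0 phi x).
Proof.
rewrite /trace0 /trace1 mulr_sumr -big_split -sumrB mulr_sumr.
by apply: eq_bigr => k _; exact: (gradDD_tgrad phi_smooth x1).
Qed.

Let gradD_xi : gradD phi x xi = 2 * (eta * 'D_xi H x).
Proof.
refine (etrans (gradD_tgrad phi_smooth x1 xi) _).
by apply: (congr1 (fun s => 2 * s)); apply: etrans (null_dir P_x) _; rewrite xi_P.
Qed.

Let sum_gd : \sum_k c 0 k * gradD phi x (b k) = 2 * (eta * 'D_xi H x).
Proof.
apply: etrans _ gradD_xi; apply: esym; refine (etrans (gradD_tgrad phi_smooth x1 xi) _).
refine (etrans (congr1 (fun s => 2 * s) (derive_xi (smooth_derive P sH))) _).
rewrite mulr_sumr; apply: eq_bigr => k _.
by rewrite (gradD_tgrad phi_smooth x1 (b k)) mulrCA.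
Qed.

Let sum_mu : \sum_k c 0 k * dot (b k) mu = m.
Proof. by rewrite /m /tang dot_suml. Qed.

Let sum_cc : \sum_k c 0 k ^+ 2 = 1.
Proof. by rewrite -c1; apply: eq_bigr => k _; rewrite expr2. Qed.

Let sum_pt : \sum_k 'D_(b k) H x * 'D_(b k) ('D_xi ('D_xi H)) x = 'D_P ('D_xi ('D_xi H)) x.
Proof.
exact (esym (derive_tgrad phi x1 (smooth_derive xi (smooth_derive xi sH)))).
Qed.

Let sum_cp : \sum_k c 0 k * 'D_(b k) H x = 'D_xi H x.
Proof. exact (esym (derive_xi sH)). Qed.

(** Here the Laplacian of the (xi, xi) entry turns into the second derivative of the trace; constant
    directions in the flat ambient space commute without curvature terms, the curvature reappearing
    through the radial terms of [jet2_lap] and [gradDD_tgrad]. *)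
Let sum_q : \sum_k 'D_(b k) ('D_(b k) ('D_xi ('D_xi H))) x = trace2 phi x xi.
Proof. by apply: eq_bigr => k _; exact (derive4_comm open_punctured sH (b k) xi x0). Qed.

Let sum_s : \sum_k 'D_(b k) ('D_(b k) ('D_xi H)) x = trace1 phi x xi.
Proof.
apply: eq_bigr => k _.
exact (etrans (derive3_comm23 open_punctured sH (b k) (b k) xi x0)
  (derive3_comm12 open_punctured sH (b k) xi (b k) x0)).
Qed.

Let sum_r : \sum_k c 0 k * 'D_(b k) ('D_mu ('D_xi H)) x = - ('D_P ('D_xi ('D_xi H)) x / phi x).
Proof.
refine (etrans (esym (derive_xi (smooth_derive mu (smooth_derive xi sH)))) _).
refine (etrans (derive3_comm12 open_punctured sH xi mu xi x0) _).
exact (derive_mu (smooth_derive xi (smooth_derive xi sH))).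
Qed.

Let sum_hmu : \sum_k c 0 k * 'D_(b k) ('D_mu H) x = eta * m.
Proof.
refine (etrans (esym (derive_xi (smooth_derive mu sH))) _).
exact (null_dir mu_x).
Qed.

Let hmm : 'D_mu ('D_mu H) x = 'D_P ('D_P H) x / phi x ^+ 2.
Proof.
refine (etrans (derive_mu (smooth_derive mu sH)) _).
have e := etrans (derive_comm P mu open_punctured sH x0) (derive_mu (smooth_derive P sH)).
by rewrite e; move: phi0 => p0; field.
Qed.

Let gradDD_xi : gradDD phi x xi =
  2 * (eta ^+ 2 + 'D_P ('D_xi ('D_xi H)) x - phi x * eta).
Proof.
refine (etrans (gradDD_tgrad phi_smooth x1 xi) _).
(* Since xi is an eigenvector, D^2 H sends it to eta xi on tangent vectors, of squared length
   eta^2. *)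
have e : \sum_k ('D_xi ('D_(b k) H) x) ^+ 2 = eta ^+ 2.
  rewrite -[RHS]mulr1 -sum_cc mulr_sumr; apply: eq_bigr => k _.
  by rewrite (null_dir (frame_tangent k x1)) xi_b exprMn.
by rewrite e etaE.
Qed.

Lemma second_order_inequality :
  0 <= 'D_xi ('D_xi (rext f)) x - 2 * ('D_xi (rext f) x) ^+ 2 / f x
    + (2 * 'D_xi (rext f) x * 'D_xi H x - 'D_P (rext f) x) / phi x
    - f x / phi x ^+ 2.
Proof.
have [E0 E1 E2] := equation_jets phi_smooth phi_pos x1 f_smooth phi_eq xi.
have [_ EP _] := equation_jets phi_smooth phi_pos x1 f_smooth phi_eq P.
have B2 := null_derive P_x.
have GP := gradD_tgrad phi_smooth x1 P.
rewrite etaE gradDD_xi in E2; rewrite gradD_xi in E1; rewrite GP in EP B2.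
have HS := sum_sqr_ge (fun k l => 'D_(b k) ('D_(b l) H) x) eta.
have sm := etrans sum_mu mE.
have sh := etrans sum_hmu (congr1 (fun s => eta * s) mE).
have KE := grad_sqr_tgrad phi_smooth x1.
have test := sum_of_tests_eq mE hmm mu_sqr sum_gdd sum_gd sm sum_cc erefl sum_pt
  sum_cp sum_q sum_r sum_s sh test_k.
exact (summed_test_conclusion (phi_pos x1) (f_pos x1) erefl KE E0 E1 EP E2 B2 HS test).
Qed.

End SecondOrderInequality.

(** Divided by -f^2 and written in g = 1/f, the last hypothesis bounds from above by 0 a sum of
    three terms: the tested hypothesis on f, the slack of the slope bound divided by p, and g/p^2 -
    g/C. The first two are nonnegative, and the third is positive because p^2 < C. *)
Lemma second_order_contradiction {R : realFieldType}
    (f g fx gx fP gP fxx gxx px p N C : R) :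
  0 < p -> 0 < f -> p ^+ 2 < C -> f * g = 1 ->
  fx * g + f * gx = 0 -> fP * g + f * gP = 0 ->
  fxx * g + 2 * fx * gx + f * gxx = 0 ->
  0 <= gxx - N + g / C -> gP - 2 * gx * px <= N * p ->
  0 <= fxx - 2 * fx ^+ 2 / f + (2 * fx * px - fP) / p - f / p ^+ 2 -> False.
Proof.
move=> p0 f0 pC fg e1 eP e2 cond slope.
have fn : f != 0 by rewrite gt_eqF.
have pn : p != 0 by rewrite gt_eqF.
have gE : g = f^-1 by apply: (mulfI fn); rewrite fg mulfV.
have C0 : 0 < C by apply: lt_trans pC; rewrite exprn_gt0.
have gxE : gx = - fx / f ^+ 2.
  have -> : gx = - (fx * g) / f by rewrite (_ : - (fx * g) = f * gx); [field | lra].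
  by rewrite gE; field.
have gPE : gP = - fP / f ^+ 2.
  have -> : gP = - (fP * g) / f by rewrite (_ : - (fP * g) = f * gP); [field | lra].
  by rewrite gE; field.
have gxxE : gxx = - (fxx * g + 2 * fx * gx) / f.
  by rewrite (_ : - (fxx * g + 2 * fx * gx) = f * gxx); [field | lra].
apply/negP; rewrite -ltNge.
have -> : fxx - 2 * fx ^+ 2 / f + (2 * fx * px - fP) / p - f / p ^+ 2 =
    - f ^+ 2 * ((gxx - N + g / C) + (N * p - (gP - 2 * gx * px)) / p
                + (g / p ^+ 2 - g / C)).
  rewrite gxxE gxE gPE gE; field.
  by rewrite fn pn gt_eqF.
rewrite mulNr oppr_lt0 mulr_gt0 ?exprn_gt0 // ltr_wpDl //.
  by rewrite addr_ge0 // divr_ge0 ?subr_ge0 // ltW.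
by rewrite subr_gt0 ltr_pM2l ?gE ?invr_gt0 // ltf_pV2 ?posrE ?exprn_gt0.
Qed.

(** * Derivatives of 1/f and the conclusion *)

Section InverseData.
Context {R : realType} {n : nat}.
Local Notation E := 'rV[R]_n.+1.
Local Notation punctured := [set y : E | y != 0].
Variable f : E -> R.
Hypotheses (f_smooth : smooth_on_sphere f) (f_pos : positive_on_sphere f).
Local Notation g := (fun y => (f y)^-1).

Lemma rext_neq0 (y : E) : y != 0 -> rext f y != 0.
Proof. by move=> y0; rewrite gt_eqF //; exact/f_pos/sphere_normalize. Qed.

Lemma smooth_inverse : smooth_on_sphere g.
Proof. exact: (smooth_inv open_punctured rext_neq0 f_smooth). Qed.

Lemma inverse_jets (x u : E) : sphere R n x ->
  [/\ f x * g x = 1,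
    'D_u (rext f) x * g x + f x * 'D_u (rext g) x = 0
  & 'D_u ('D_u (rext f)) x * g x + 2 * 'D_u (rext f) x * 'D_u (rext g) x
      + f x * 'D_u ('D_u (rext g)) x = 0].
Proof.
move=> x1; have x0 := sphere_neq0 x1.
have J := jet2M
  (jet2_eqv (jet2_line u open_punctured f_smooth x0) (rext_sphere f x1) erefl erefl)
  (jet2_eqv (jet2_line u open_punctured smooth_inverse x0) (rext_sphere g x1) erefl erefl).
have nE : \forall t \near (0 : R), rext f (x + t *: u) * rext g (x + t *: u) = 1.
  apply: filterS (near_line_punctured u x0) => t y0.
  exact: mulfV (rext_neq0 y0).
exact (jet2_unique (jet2_near nE J) (jet2_cst 1)).
Qed.

End InverseData.

Lemma psd_null_unit {R : realType} n (A : 'M[R]_n) : psdmx A -> ~ pdmx A ->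
  exists c : 'rV[R]_n, dot c c = 1 /\ dot (c *m A) c = 0.
Proof.
move=> Apsd Anpd; apply: contra_notP Anpd => nc v v0.
rewrite lt_neqAle Apsd andbT; apply/eqP => e; apply: nc.
have N0 : enorm v != 0 by rewrite gt_eqF // enorm_gt0.
exists ((enorm v)^-1 *: v); split; first by rewrite dotZl dotZr -enorm_sqr; field.
by rewrite -scalemxAl dotZl dotZr -e !mulr0.
Qed.

Theorem theorem4p1 (R : realType) (n : nat) (n_gt0 : (0 < n)%N)
    (f phi : 'rV[R]_n.+1 -> R)
    (f_smooth : smooth_on_sphere f)
    (f_pos : positive_on_sphere f)
    (f_even : even_on_sphere f)
    (f_cond : forall x, sphere R n x ->
      let g := fun y => (f y)^-1 in
      psdmx (hess g x - (enorm (grad g x))%:M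
             + (g x / (8 / n%:R * sup (f @` sphere R n) + 2))%:M))
    (phi_smooth : smooth_on_sphere phi)
    (phi_pos : positive_on_sphere phi)
    (phi_even : even_on_sphere phi)
    (phi_hconvex : h_convex phi)
    (phi_eq : forall x, sphere R n x ->
      laplacian phi x - n%:R / 2 * (enorm (grad phi x) ^+ 2 / phi x)
        + n%:R / 2 * (phi x - (phi x)^-1)
      = (phi x)^-1 * f x)
    (phi_int : forall k : nat, (k <= n.-1)%N ->
      sphere_int (fun x =>
        phi x ^ (k%:Z - n%:Z) * sigma k.+1 (Umx phi x))
      = 'C(n, k.+1)%:R / 'C(n, k)%:R *
        sphere_int (fun x =>
          (enorm (grad phi x) ^+ 2 / (2 * phi x)
            + 2^-1 * (phi x - (phi x)^-1))
          * phi x ^ (k%:Z - n%:Z) * sigma k (Umx phi x))) :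
  uniformly_h_convex phi.
Proof.
move=> x x1; apply: contrapT => /(psd_null_unit (phi_hconvex x x1))[c [c1 c0]].
have x0 := sphere_neq0 x1; pose xi := tang x c; pose g y := (f y)^-1.
have g_smooth : smooth_on_sphere g := smooth_inverse f_smooth f_pos.
have xi_null : 2 * phi x * 'D_xi ('D_xi (hsupport phi)) x
    = grad_sqr (hsupport phi) x + 1.
  have := Umx_quadratic phi_smooth phi_pos c x1.
  rewrite c0 c1 mulr0 mulr1 => /esym/eqP; rewrite subr_eq0 => /eqP e; exact e.
have ineq := second_order_inequality f_smooth f_pos phi_smooth phi_pos phi_hconvex
  phi_eq x1 c1 xi_null.
have [fg fx fxx] := inverse_jets f_smooth f_pos xi x1.
have [_ fP _] := inverse_jets f_smooth f_pos (tgrad phi x) x1.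
have cond : 0 <= 'D_xi ('D_xi (rext g)) x - enorm (grad g x)
    + g x / (8 / n%:R * sup (f @` sphere R n) + 2).
  have := f_cond x x1 c; rewrite -/g mulmxDr mulmxBr !mul_mx_scalar !dotDl dotNl !dotZl c1.
  by rewrite (hess_quadratic g_smooth c x1) !mulr1.
pose gam := tang x (\row_k 'D_(frame x k) (rext g) x).
have gam_xi : dot gam xi = 'D_xi (rext g) x.
  refine (etrans (dotC _ _) (etrans (dot_tang x c _) (esym _))).
  refine (etrans (derive_tang x1 c g_smooth) _).
  by apply: eq_bigr => k _; rewrite mxE.
have gam_sqr : dot gam gam = dot (grad g x) (grad g x).
  rewrite -[RHS]enorm_sqr (enorm_grad_frame g_smooth x1) (dot_tang x).
  by apply: eq_bigr => k _; rewrite mxE expr2.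
(* The reflection of Dg in the hyperplane orthogonal to xi, so |w| = |Dg|. The derivative of phi
   along w is <Dg, Dphi> - 2 g_xi phi_xi, so the slope bound controls both first-order terms at
   once. *)
pose w := - (2 * 'D_xi (rext g) x) *: xi + gam.
have w_x : dot w x = 0.
  by rewrite dotDl dotZl (dot_tang_base c x1) (dot_tang_base _ x1) mulr0 addr0.
have w_norm : enorm w = enorm (grad g x).
  rewrite /enorm -gam_sqr; congr Num.sqrt.
  have := dot_comb (- (2 * 'D_xi (rext g) x)) 1 xi gam; rewrite scale1r -/w => ->.
  by rewrite (dotC xi gam) gam_xi (dot_tang x c c) c1; ring.
have frame_deriv k : 'D_(frame x k) (hsupport phi) x = 'D_(frame x k) (rext phi) x.
  by rewrite derive_support_sphere // dotC frame_tangent // mulr0 addr0.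
have slope := slope_bound phi_smooth phi_pos phi_even phi_hconvex x1 w_x.
have w_deriv : 'D_w (rext phi) x = 'D_(tgrad phi x) (rext g) x
    - 2 * 'D_xi (rext g) x * 'D_xi (hsupport phi) x.
  refine (etrans (derive_linear _ xi gam phi_smooth x0) _).
  rewrite addrC mulNr; congr (_ - _ * _).
    refine (etrans (derive_tang x1 _ phi_smooth) (esym _)).
    refine (etrans (derive_tgrad phi x1 g_smooth) _).
    by apply: eq_bigr => k _; rewrite mxE frame_deriv mulrC.
  rewrite derive_support_sphere // (dotC x) (dot_tang_base c x1).
  by rewrite mulr0 addr0.
rewrite w_deriv w_norm in slope.
exact (second_order_contradiction (phi_pos x x1) (f_pos x x1)
  (support_sqr_bound phi_smooth phi_pos phi_even phi_hconvex n_gt0 f_smooth phi_eq x1)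
  fg fx fP fxx cond slope ineq).
Qed.
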